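(* All top-dimensional (i.e. $3$-dimensional) faces of the convex hull $\Pi$ are tetrahedra whose vertices are of the form $x_n,x_{n+a},x_{n+b},x_{n+a+b}$, where $n\in\mathbb{Z}$ and $a,b$ are the denominators of an admissible pair of rationals $\{\frac{\alpha}{a},\frac{\beta}{b}\}$.
   Context: Fix integers $q\ge 5$ and $p\in\{2,\dots,q-2\}$ with $p$ coprime to $q$, and let $Q:=\frac pq\in(0,1)$. Identify $\mathbb{C}^2$ with $\mathbb{R}^4$ in the standard way. Let $\varphi:\mathbb{C}^2\to\mathbb{C}^2$, $\varphi(z,z')=(e^{2i\pi/q}z,\,e^{2ip\pi/q}z')$. Let $x_0=(1,1)\in\mathbb{C}^2$ and, for $k\in\mathbb{Z}$, $x_k=\varphi^k(x_0)$ (so $x_{k+q}=x_k$). Let $\Pi\subset\mathbb{R}^4$ be the convex hull of $\{x_0,\dots,x_{q-1}\}$. Two rationals $\frac us,\frac vt$ in reduced form (with $\infty=\frac10$ allowed) are called Farey neighbors if $|ut-vs|=1$. A pair of rationals $A=\frac{\alpha}{a},B=\frac{\beta}{b}\in[0,1]$ (in reduced form, $a,b\ge1$) is called admissible if $A,B$ are Farey neighbors, $Q$ lies strictly between $A$ and $B$, at most one of $A,B$ is a Farey neighbor of $Q$, and at most one of $A,B$ is a Farey neighbor of $\infty$ (i.e. belongs to $\{0,1\}$). *)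

(* Defs.v *)
From HB Require Import structures.
From mathcomp Require Import all_boot all_order all_algebra.
From mathcomp Require Import all_classical all_reals all_analysis.
From mathcomp Require Import complex.

Set Implicit Arguments.
Unset Strict Implicit.
Unset Printing Implicit Defensive.

Import Order.TTheory GRing.Theory Num.Theory.

Local Open Scope classical_set_scope.
Local Open Scope ring_scope.
Local Open Scope complex_scope.

Definition conv_hull (R : realType) (m : nat) (A : set 'rV[R]_m) :
    set 'rV[R]_m :=
  smallest (@convex_set R 'rV[R]_m) A.

Definition affinely_independent (R : realType) (m d : nat)
    (v : 'I_d.+1 -> 'rV[R]_m) : bool :=
  row_free (\matrix_(i < d) (v (lift ord0 i) - v ord0)).

(* The affine hull of A has dimension d. *)
Definition has_affine_dim (R : realType) (m : nat) (A : set 'rV[R]_m)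
    (d : nat) : Prop :=
  (exists v : 'I_d.+1 -> 'rV[R]_m,
     affinely_independent v /\ forall i, A (v i)) /\
  ~ (exists v : 'I_d.+2 -> 'rV[R]_m,
       affinely_independent v /\ forall i, A (v i)).

(* Face of a polytope: the set where a valid linear inequality is tight.
   With l = 0 this includes P itself (c = 0) and the empty set (c > 0). *)
Definition is_face (R : realType) (m : nat) (P F : set 'rV[R]_m) : Prop :=
  exists (l : 'cV[R]_m) (c : R),
    (forall x, P x -> (x *m l) 0 0 <= c) /\
    F = [set x | P x /\ (x *m l) 0 0 = c].

Definition is_tetrahedron_on (R : realType) (m : nat) (F : set 'rV[R]_m)
    (v0 v1 v2 v3 : 'rV[R]_m) : Prop :=
  affinely_independent (fun i : 'I_4 => [:: v0; v1; v2; v3]`_i) /\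
  F = conv_hull [set` [:: v0; v1; v2; v3]].

Definition expi (R : realType) (t : R) : R[i] := (cos t) +i* (sin t).

Section Orbit.
Variables (R : realType) (q p : nat).

Definition phi (z : R[i] * R[i]) : R[i] * R[i] :=
  (expi (2 * pi / q%:R) * z.1, expi (2 * p%:R * pi / q%:R) * z.2).

Definition phi_inv (z : R[i] * R[i]) : R[i] * R[i] :=
  (z.1 / expi (2 * pi / q%:R), z.2 / expi (2 * p%:R * pi / q%:R)).

Definition orbit_point (k : int) : R[i] * R[i] :=
  match k with
  | Posz n => iter n phi (1, 1)
  | Negz n => iter n.+1 phi_inv (1, 1)
  end.

Definition C2_to_R4 (z : R[i] * R[i]) : 'rV[R]_4 :=
  \row_j [:: complex.Re z.1; complex.Im z.1;
             complex.Re z.2; complex.Im z.2]`_j.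

Definition xpt (k : int) : 'rV[R]_4 := C2_to_R4 (orbit_point k).

Definition Pi_hull : set 'rV[R]_4 :=
  conv_hull [set xpt (Posz k) | k in [set k | (k < q)%N]].

End Orbit.

Lemma expi_neq0 (R : realType) (t : R) : expi t != 0.
Proof.
apply/eqP => -[c0 s0]; have := cos2Dsin2 t.
by rewrite c0 s0 expr0n addr0 => /eqP; rewrite eq_sym oner_eq0.
Qed.

Lemma phiK (R : realType) (q p : nat) : cancel (@phi R q p) (phi_inv q p).
Proof. by case=> z w; rewrite /phi/phi_inv/= !(mulrC (expi _)) !mulfK ?expi_neq0. Qed.

Lemma phi_invK (R : realType) (q p : nat) : cancel (@phi_inv R q p) (phi q p).
Proof. by case=> z w; rewrite /phi/phi_inv/= !(mulrC (expi _)) !divfK ?expi_neq0. Qed.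

(* Reduced fraction of an element of Q + {oo}, where None stands for
   oo = 1/0. *)
Definition reduced_frac (x : option rat) : int * int :=
  if x is Some r then (numq r, denq r) else (1, 0).

Definition farey_neighbors (x y : option rat) : bool :=
  let: (u, s) := reduced_frac x in
  let: (v, t) := reduced_frac y in
  `|u * t - v * s| == 1.

Definition admissible (Q A B : rat) : Prop :=
  (0 <= A <= 1) /\ (0 <= B <= 1) /\
  farey_neighbors (Some A) (Some B) /\
  (A < Q < B \/ B < Q < A) /\
  ~ (farey_neighbors (Some A) (Some Q) /\ farey_neighbors (Some B) (Some Q)) /\
  ~ (farey_neighbors (Some A) None /\ farey_neighbors (Some B) None).

(* Main.v *)
Require Import Defs.
From HB Require Import structures.
From mathcomp Require Import all_boot all_order all_algebra.
From mathcomp Require Import all_classical all_reals all_analysis.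
From mathcomp Require Import complex.
From mathcomp Require Import ring lra zify.

(** Why the theorem holds.

    Each admissible pair A = alpha/a, B = beta/b should give, for every n, a
    facet with vertices x_n, x_(n+a), x_(n+b), x_(n+a+b).  Two facts are
    needed: the hyperplane through these four points supports the orbit, and
    no facet is missed.

    Supporting hyperplanes.  Put y = p a - alpha q > 0 and z = beta q - p b > 0.
    The vectors (a, y) and (b, -z) form a basis, of determinant
    a z + b y = q, of the lattice of the integer points (k, l) with
    l = p k mod q, which contains (q Z)^2 and whose quotient by it indexes the
    orbit.  After centering at the midpoint of the parallelogram spanned by the
    basis, the functional becomes, up to a sign, u cos X + v cos Y with
      u = sin (pi y / q) sin (pi z / q),  v = sin (pi a / q) sin (pi b / q),
    a choice that gives the four corners one common value M.  The four bounds
    tan tan tan < tan of [tan_prod_lt], in which admissibility enters, give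
    |u - v| < M.  Under this condition the superlevel set of M in
    the square [-pi, pi]^2 is strictly convex: it lies on one side of each
    tangent to its boundary ([level_set_below_tangent]).  Using the tangents
    at the corners, it contains no other point of the centered lattice
    ([level_set_avoids_lattice]), so every other orbit point lies strictly
    below the hyperplane ([support_functional_le1]).

    Completeness.  Call the tetrahedra above known.  Removing a vertex from a
    known tetrahedron leaves a triangle that lies in another known one: the
    pair {A, B} is replaced by a parent or a child in the Farey graph, or, at
    the two ends of the chain of admissible pairs, the tetrahedron is merely
    translated ([tet_pivot]).  A family of supporting simplices with this
    property contains all the facets, by the argument of the simplex method:
    given y, the simplex whose functional is largest at y has y in its cone,
    for otherwise crossing a wall that separates it from y would increase the
    value ([pivot_cones_cover], [pivot_family_facet]). *)

Set Implicit Arguments.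
Unset Strict Implicit.
Unset Printing Implicit Defensive.

Import Order.TTheory GRing.Theory Num.Theory.
Import numFieldNormedType.Exports.

Local Open Scope classical_set_scope.
Local Open Scope ring_scope.

(** * Affine independence and convex hulls *)

(** Substituting the value - sum_(i > 0) c i for the coefficient of v 0 turns
    a relation with zero total weight into a relation between the differences
    v i - v 0. *)
Lemma aff_indepP (R : realType) (m d : nat) (v : 'I_d.+1 -> 'rV[R]_m) :
  affinely_independent v <->
  forall c : 'I_d.+1 -> R, \sum_i c i = 0 -> \sum_i c i *: v i = 0 ->
    forall i, c i = 0.
Proof.
rewrite /affinely_independent; set A := \matrix_(i < d) _.
have mulA (w : 'rV_d) : w *m A = \sum_i w 0 i *: (v (lift ord0 i) - v ord0).
  by rewrite mulmx_sum_row; apply: eq_bigr => i _; rewrite rowK.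
split=> [free c c0 cv|H].
  pose w : 'rV_d := \row_i c (lift ord0 i).
  have : w *m A = 0.
    rewrite mulA (eq_bigr (fun i => c (lift ord0 i) *: v (lift ord0 i)
       - c (lift ord0 i) *: v ord0)); last by move=> i _; rewrite mxE scalerBr.
    rewrite sumrB -scaler_suml.
    move: c0 cv; rewrite !big_ord_recl /= => /eqP; rewrite addrC addr_eq0 => /eqP -> .
    by rewrite scaleNr opprK addrC.
  move=> w0; have {}w0 : w = 0.
    by apply: (row_free_inj free); rewrite w0 mul0mx.
  have cl i : c (lift ord0 i) = 0 by have := congr1 (fun M : 'rV_d => M 0 i) w0; rewrite !mxE.
  have c00 : c ord0 = 0.
    by move: c0; rewrite big_ord_recl big1 ?addr0.
  by move=> i; case: (unliftP ord0 i) => [j|] ->.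
rewrite -kermx_eq0; apply/rowV0P => w /sub_kermxP; rewrite mulA => w0.
pose c i := if unlift ord0 i is Some j then w 0 j else - \sum_j w 0 j.
have cl i : c (lift ord0 i) = w 0 i by rewrite /c liftK.
have c00 : c ord0 = - \sum_j w 0 j by rewrite /c unlift_none.
have c0 : \sum_i c i = 0.
  by rewrite big_ord_recl c00 [X in _ + X = _](eq_bigr (w 0)) ?addNr // => i _; rewrite cl.
have cv : \sum_i c i *: v i = 0.
  rewrite big_ord_recl c00 [X in _ + X = _](eq_bigr (fun i => w 0 i *: v (lift ord0 i))); last first.
    by move=> i _; rewrite cl.
  rewrite scaleNr addrC scaler_suml -sumrB -[RHS]w0.
  by apply: eq_bigr => i _; rewrite scalerBr.
by apply/rowP => j; rewrite mxE -cl (H c c0 cv).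
Qed.

Lemma mulmx_col_sum (R : comPzRingType) (m d : nat) (c : 'I_d -> R)
    (v : 'I_d -> 'rV[R]_m) (l : 'cV[R]_m) :
  ((\sum_i c i *: v i) *m l) 0 0 = \sum_i c i * (v i *m l) 0 0.
Proof.
rewrite mulmx_suml summxE; apply: eq_bigr => i _.
by rewrite -scalemxAl; set X := v i *m l; rewrite mxE.
Qed.

Lemma mulmx_colB (R : pzRingType) (m : nat) (x : 'rV[R]_m) (l l' : 'cV[R]_m) :
  (x *m (l - l')) 0 0 = (x *m l) 0 0 - (x *m l') 0 0.
Proof. by rewrite mulmxBr; set X := x *m l; set Y := x *m l'; rewrite !mxE. Qed.

Lemma mulmx_col_comb (R : comPzRingType) (m : nat) (s t : R)
    (x y : 'rV[R]_m) (l : 'cV[R]_m) :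
  ((s *: x + t *: y) *m l) 0 0 = s * (x *m l) 0 0 + t * (y *m l) 0 0.
Proof.
by rewrite mulmxDl -!scalemxAl; set X := x *m l; set Y := y *m l; rewrite !mxE.
Qed.

Lemma conv_hull_half_space (R : realType) (m : nat) (A : set 'rV[R]_m)
    (l : 'cV[R]_m) (c : R) :
  (forall x, A x -> (x *m l) 0 0 <= c) ->
  forall x, conv_hull A x -> (x *m l) 0 0 <= c.
Proof.
move=> Ac x /(_ [set y | (y *m l) 0 0 <= c]); apply; split=> // y z t; rewrite !inE /= => yc zc.
rewrite /conv /= mulmx_col_comb /unstable.onem.
have t0 : 0 <= t%:num by [].
have t1 : t%:num <= 1 by [].
have -> : c = t%:num * c + (1 - t%:num) * c by ring.
by apply: lerD; apply: ler_wpM2l => //; rewrite subr_ge0.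
Qed.

Lemma conv_hull_sub (R : realType) (m : nat) (A B : set 'rV[R]_m) :
  convex_set B -> A `<=` B -> conv_hull A `<=` B.
Proof. by move=> cB AB x /(_ B); apply; split. Qed.

Lemma conv_hull_convex (R : realType) (m : nat) (A : set 'rV[R]_m) :
  convex_set (conv_hull A).
Proof.
move=> x y t; rewrite !inE => hx hy B [cB AB].
have := cB x y t; rewrite !inE; apply; [exact: hx | exact: hy].
Qed.

Lemma sub_conv_hull (R : realType) (m : nat) (A : set 'rV[R]_m) : A `<=` conv_hull A.
Proof. by move=> x Ax B [_ ]; apply. Qed.

(** Peeling off one point leaves a combination of total weight s, which is
    rescaled by 1 / s before the induction hypothesis applies. *)
Lemma convex_set_sum (R : realType) (m d : nat) (B : set 'rV[R]_m)
    (v : 'I_d -> 'rV[R]_m) (c : 'I_d -> R) :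
  convex_set B -> (forall i, B (v i)) -> (forall i, 0 <= c i) ->
  \sum_i c i = 1 -> B (\sum_i c i *: v i).
Proof.
move=> cB; elim: d v c => [|d IH] v c Bv c0 c1.
  by move/eqP: c1; rewrite big_ord0 eq_sym oner_eq0.
rewrite big_ord_recl; move: c1; rewrite big_ord_recl => c1.
set s := \sum_(i < d) _ in c1 *.
have s0 : 0 <= s by apply: sumr_ge0.
have [sz|sn] := eqVneq s 0.
  rewrite big1 => [|i _]; last first.
    have /eqP := sz; rewrite psumr_eq0 // => /allP /(_ i).
    by rewrite mem_index_enum => /(_ isT) /eqP ->; rewrite scale0r.
  have -> : c ord0 = 1 by rewrite -c1 sz addr0.
  by rewrite addr0 scale1r.
have sp : 0 < s by rewrite lt0r sn.
have Bw : B (\sum_(i < d) (c (lift ord0 i) / s) *: v (lift ord0 i)).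
  apply: IH => //; first by move=> i; rewrite divr_ge0.
  by rewrite -mulr_suml divff.
have cle : 0 <= c ord0 <= 1 by rewrite c0 /=; lra.
have := cB (v ord0) _ (Itv01 (andP cle).1 (andP cle).2).
move=> /(_ (\sum_(i < d) (c (lift ord0 i) / s) *: v (lift ord0 i))).
rewrite !inE => /(_ (Bv _) Bw).
rewrite /conv /= /unstable.onem; have -> : 1 - c ord0 = s by lra.
rewrite scaler_sumr (eq_bigr (fun i => c (lift ord0 i) *: v (lift ord0 i))) //.
by move=> i _; rewrite scalerA mulrC divfK.
Qed.

(** * Facets from a pivot-closed family of simplices *)

(** The columns D j form, up to scaling, a basis dual to T. *)
Lemma dual_expansion (R : fieldType) (n : nat) (T : 'I_n -> 'rV[R]_n)
    (D : 'I_n -> 'cV[R]_n) :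
  (forall j, (T j *m D j) 0 0 != 0) ->
  (forall j j', j != j' -> (T j *m D j') 0 0 = 0) ->
  forall x, x = \sum_j ((x *m D j) 0 0 / (T j *m D j) 0 0) *: T j.
Proof.
move=> Dn D0 x; pose A := \matrix_j T j.
have mulA (w : 'rV_n) : w *m A = \sum_j w 0 j *: T j.
  by rewrite mulmx_sum_row; apply: eq_bigr => j _; rewrite rowK.
have coord (w : 'rV_n) j : ((w *m A) *m D j) 0 0 = w 0 j * (T j *m D j) 0 0.
  rewrite mulA mulmx_col_sum (bigD1 j) //= big1 ?addr0 // => k kj.
  by rewrite D0 // mulr0.
have free : row_free A.
  rewrite -kermx_eq0; apply/rowV0P => w /sub_kermxP w0.
  apply/rowP => j; rewrite mxE; apply: (mulIf (Dn j)).
  by rewrite -coord w0 mul0mx mxE mul0r.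
have /submxP[w ->] : (x <= A)%MS by apply: submx_full; rewrite row_full_unit -row_free_unit.
rewrite {1}mulA; apply: eq_bigr => j _.
by rewrite coord mulfK.
Qed.

(** Each T i is a simplex with vertices in S lying on the hyperplane L i = 1
    that supports S.  The last clause provides, for each vertex j, a member of
    the family on the other side of the face opposite to j: its functional is
    1 on that face and smaller than 1 at T i j. *)
Definition pivot_family (R : realType) (d : nat) (S : set 'rV[R]_d.+1)
    (I : finType) (P : pred I) (T : I -> 'I_d.+1 -> 'rV[R]_d.+1)
    (L : I -> 'cV[R]_d.+1) : Prop :=
  forall i, P i ->
  [/\ forall j, S (T i j), forall x, S x -> (x *m L i) 0 0 <= 1,
      forall j, (T i j *m L i) 0 0 = 1 &
      forall j, exists i', [/\ P i', forall k, k != j -> (T i k *m L i') 0 0 = 1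
                             & (T i j *m L i') 0 0 < 1]].

Section PivotFamily.
Variables (R : realType) (d : nat) (S : set 'rV[R]_d.+1) (I : finType).
Variables (P : pred I) (T : I -> 'I_d.+1 -> 'rV[R]_d.+1) (L : I -> 'cV[R]_d.+1).
Hypothesis piv : pivot_family S P T L.

(** L i - L (nb j), where nb j is the neighbour opposite to j, vanishes at all
    the vertices of T i except j.  So the neighbours give the basis dual to
    the vertices, and the vertices are linearly independent; moreover a
    coordinate is nonnegative as soon as L i is at least L (nb j). *)
Lemma pivot_coordinates i : P i -> exists (nb : 'I_d.+1 -> I) (g : 'I_d.+1 -> R),
  [/\ forall j, P (nb j), forall j, 0 < g j &
      forall x, x = \sum_j ((x *m (L i - L (nb j))) 0 0 / g j) *: T i j].
Proof.
move=> Pi; have [_ _ TL1 nbex] := piv Pi.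
have [nb nbP] := choice nbex.
exists nb, (fun j => (T i j *m (L i - L (nb j))) 0 0); split.
- by move=> j; have [] := nbP j.
- by move=> j; have [_ _ lt] := nbP j; rewrite mulmx_colB TL1 subr_gt0.
- apply: dual_expansion => [j|j j' jj'].
    by have [_ _ lt] := nbP j; rewrite mulmx_colB TL1 subr_eq0 gt_eqF.
  by have [_ eq _] := nbP j'; rewrite mulmx_colB TL1 eq // subrr.
Qed.

Lemma pivot_vertices_span i (l l' : 'cV[R]_d.+1) : P i ->
  (forall j, (T i j *m l) 0 0 = (T i j *m l') 0 0) ->
  forall x : 'rV[R]_d.+1, (x *m l) 0 0 = (x *m l') 0 0.
Proof.
move=> Pi E x; have [nb [g [_ _ ex]]] := pivot_coordinates Pi.
by rewrite (ex x) !mulmx_col_sum; apply: eq_bigr => j _; rewrite E.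
Qed.

(** The simplex method: when L i y is maximal, no pivot increases it, which
    means that all the coordinates of y are nonnegative. *)
Lemma pivot_cones_cover i0 : P i0 -> forall y, exists i (c : 'I_d.+1 -> R),
  [/\ P i, forall j, 0 <= c j & y = \sum_j c j *: T i j].
Proof.
move=> Pi0 y.
case: (@arg_maxP _ _ _ i0 P (fun i => (y *m L i) 0 0) Pi0) => i Pi max.
have [nb [g [Pnb g0 ex]]] := pivot_coordinates Pi.
exists i, (fun j => (y *m (L i - L (nb j))) 0 0 / g j); split=> // j.
rewrite divr_ge0 ?(ltW (g0 j)) // mulmx_colB subr_ge0.
exact: max.
Qed.

Lemma pivot_affinely_independent i : P i -> affinely_independent (T i).
Proof.
move=> Pi; apply/aff_indepP => c _ cT.
have [nb [g [_ g0 ex]]] := pivot_coordinates Pi.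
have [_ _ TL1 nbex] := piv Pi.
move=> j; have [i' [_ eq lt]] := nbex j.
have : ((\sum_j c j *: T i j) *m (L i - L i')) 0 0 = 0 by rewrite cT mul0mx mxE.
rewrite mulmx_col_sum (bigD1 j) //= big1 ?addr0; last first.
  by move=> k kj; rewrite mulmx_colB TL1 eq // subrr mulr0.
rewrite mulmx_colB TL1 => /eqP; rewrite mulf_eq0 subr_eq0 => /orP[/eqP//|].
by move/eqP => e; rewrite -e ltxx in lt.
Qed.

(** A neighbour of T i has a vertex off the hyperplane L i = 1, since otherwise
    the two functionals would coincide. *)
Lemma pivot_full_dim i : P i -> exists v : 'I_d.+2 -> 'rV[R]_d.+1,
  affinely_independent v /\ forall k, S (v k).
Proof.
move=> Pi; have [TS _ TL1 nbex] := piv Pi.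
have [i' [Pi' eq lt]] := nbex ord0; have [TS' _ TL1' _] := piv Pi'.
have [[j jn]|no] := pselect (exists j, (T i' j *m L i) 0 0 != 1); last first.
  have E j : (T i' j *m L i) 0 0 = (T i' j *m L i') 0 0.
    by rewrite TL1'; apply/eqP; apply: contra_notT no => ?; exists j.
  by move: lt; rewrite -(pivot_vertices_span Pi' E) TL1 ltxx.
exists (fun k => if unlift ord0 k is Some h then T i h else T i' j); split; last first.
  by move=> k; case: unliftP.
apply/aff_indepP => c c0 cv.
have c00 : c ord0 = 0.
  have eL : c ord0 * (T i' j *m L i) 0 0 + \sum_h c (lift ord0 h) = 0.
    have := congr1 (fun x : 'rV_d.+1 => (x *m L i) 0 0) cv.
    rewrite mulmx_col_sum mul0mx [RHS]mxE big_ord_recl unlift_none => e; rewrite -[RHS]e.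
    by congr (_ + _); apply: eq_bigr => h _; rewrite liftK TL1 mulr1.
  have : c ord0 * ((T i' j *m L i) 0 0 - 1) == 0.
    by move: c0; rewrite big_ord_recl => c0; apply/eqP; lra.
  by rewrite mulf_eq0 subr_eq0 (negbTE jn) orbF => /eqP.
have /aff_indepP free := pivot_affinely_independent Pi.
have cl h : c (lift ord0 h) = 0.
  apply: (free (fun h => c (lift ord0 h))).
    by move: c0; rewrite big_ord_recl c00 add0r.
  move: cv; rewrite big_ord_recl c00 scale0r add0r => e; rewrite -[RHS]e.
  by apply: eq_bigr => k _; rewrite liftK.
by move=> k; case: (unliftP ord0 k) => [h|] ->.
Qed.

(** Were c nonpositive, l would be nonpositive on all the cones, hence
    everywhere, including at l itself. *)
Lemma facet_functional_gt0 i0 (l : 'cV[R]_d.+1) (c : R) : P i0 -> l != 0 ->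
  (forall x, S x -> (x *m l) 0 0 <= c) -> 0 < c.
Proof.
move=> Pi0 ln lc; have [i [a [Pi a0 eq]]] := pivot_cones_cover Pi0 l^T.
have [TS _ _ _] := piv Pi.
rewrite ltNge; apply/negP => c0; case/negP: ln; apply/eqP/colP => k.
have le0 : (l^T *m l) 0 0 <= 0.
  rewrite eq mulmx_col_sum; apply: sumr_le0 => j _.
  by apply: mulr_ge0_le0 => //; apply: le_trans c0; exact: lc.
have : \sum_j l j 0 ^+ 2 == 0.
  rewrite eq_le sumr_ge0 ?andbT; last by move=> j _; exact: sqr_ge0.
  move: le0; rewrite mxE; under eq_bigr do rewrite mxE -expr2; done.
rewrite psumr_eq0; last by move=> j _; exact: sqr_ge0.
by move=> /allP /(_ k); rewrite mem_index_enum => /(_ isT); rewrite sqrf_eq0 mxE => /eqP.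
Qed.

(** Let the sum of the v k lie in the cone of T i, with coefficients a j.
    Evaluating l on it gives (d + 1) c <= c * sum_j a j, and sum_j a j is the
    sum of the numbers L i (v k), which are at most 1.  So each of them is 1,
    and c L i agrees with l on the v k, which span the space. *)
Lemma facet_supported_by_simplex i0 (l : 'cV[R]_d.+1) (c : R)
    (v : 'I_d.+1 -> 'rV[R]_d.+1) : P i0 -> 0 < c ->
  (forall x, S x -> (x *m l) 0 0 <= c) ->
  affinely_independent v -> (forall k, conv_hull S (v k)) ->
  (forall k, (v k *m l) 0 0 = c) ->
  exists2 i, P i & forall x : 'rV[R]_d.+1, (x *m l) 0 0 = c * (x *m L i) 0 0.
Proof.
move=> Pi0 c0 lc /aff_indepP vfree vS vl.
have [i [a [Pi a0 eq]]] := pivot_cones_cover Pi0 (\sum_k 1 *: v k).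
have [TS LS TL1 _] := piv Pi.
exists i => //.
have Lv1 k : (v k *m L i) 0 0 <= 1 by exact: (conv_hull_half_space LS).
have ge : \sum_(k < d.+1) 1 <= \sum_k (v k *m L i) 0 0.
  rewrite -(ler_pM2l c0) mulr_sumr.
  have -> : \sum_(k < d.+1) c * 1 = \sum_j a j * (T i j *m l) 0 0.
    rewrite -mulmx_col_sum -eq mulmx_col_sum.
    by apply: eq_bigr => k _; rewrite vl mulrC.
  have -> : \sum_k (v k *m L i) 0 0 = \sum_j a j.
    transitivity (((\sum_k 1 *: v k) *m L i) 0 0).
      by rewrite mulmx_col_sum; apply: eq_bigr => k _; rewrite mul1r.
    by rewrite eq mulmx_col_sum; apply: eq_bigr => j _; rewrite TL1 mulr1.
  rewrite mulr_sumr; apply: ler_sum => j _; rewrite mulrC.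
  by apply: ler_wpM2r => //; exact: lc.
have Lv k : (v k *m L i) 0 0 = 1.
  have : \sum_k (1 - (v k *m L i) 0 0) == 0.
    rewrite eq_le sumr_ge0 ?andbT; last by move=> j _; rewrite subr_ge0.
    by rewrite sumrB subr_le0.
  rewrite psumr_eq0; last by move=> j _; rewrite subr_ge0.
  by move=> /allP /(_ k); rewrite mem_index_enum => /(_ isT); rewrite subr_eq0 => /eqP.
pose V := \matrix_k v k.
have mulV (w : 'rV_d.+1) : w *m V = \sum_k w 0 k *: v k.
  by rewrite mulmx_sum_row; apply: eq_bigr => j _; rewrite rowK.
have Vfree : row_free V.
  rewrite -kermx_eq0; apply/rowV0P => w /sub_kermxP; rewrite mulV => w0.
  apply/rowP => k; rewrite [RHS]mxE; apply: (vfree (fun k => w 0 k)) => //.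
  have := congr1 (fun x : 'rV_d.+1 => (x *m L i) 0 0) w0.
  rewrite mulmx_col_sum mul0mx [RHS]mxE => e; rewrite -[RHS]e.
  by apply: eq_bigr => h _; rewrite Lv mulr1.
move=> x; have /submxP[w ->] : (x <= V)%MS.
  by apply: submx_full; rewrite row_full_unit -row_free_unit.
rewrite mulV !mulmx_col_sum mulr_sumr; apply: eq_bigr => k _.
by rewrite vl Lv; ring.
Qed.

Theorem pivot_family_facet i0 (F : set 'rV[R]_d.+1) : P i0 ->
  is_face (conv_hull S) F -> has_affine_dim F d ->
  exists i, [/\ P i, affinely_independent (T i) & F = conv_hull (range (T i))].
Proof.
move=> Pi0 [l [c [lc FE]]] [[v [vfree vF]] nodim].
have lcS x : S x -> (x *m l) 0 0 <= c by move=> Sx; apply: lc; exact: sub_conv_hull.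
have vF' k : conv_hull S (v k) /\ (v k *m l) 0 0 = c by have := vF k; rewrite FE.
have ln : l != 0.
  apply/negP => /eqP l0; apply: nodim.
  have c0 : c = 0 by rewrite -(vF' ord0).2 l0 mulmx0 mxE.
  have [w [wfree wS]] := pivot_full_dim Pi0; exists w; split=> // k.
  by rewrite FE /=; split; [exact: sub_conv_hull | rewrite l0 mulmx0 mxE c0].
have c0 := facet_functional_gt0 Pi0 ln lcS.
have [i Pi lE] := facet_supported_by_simplex Pi0 c0 lcS vfree
  (fun k => (vF' k).1) (fun k => (vF' k).2).
exists i; split=> //; first exact: pivot_affinely_independent.
have [TS LS TL1 _] := piv Pi.
have cvx := @conv_hull_convex R d.+1.
rewrite FE; apply/seteqP; split=> x.
- case=> xS xl; have L1 : (x *m L i) 0 0 = 1.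
    by apply: (mulfI (lt0r_neq0 c0)); rewrite -lE xl mulr1.
  have [nb [g [Pnb g0 ex]]] := pivot_coordinates Pi.
  rewrite (ex x); apply: convex_set_sum.
  + exact: cvx.
  + by move=> j; apply: sub_conv_hull; exists j.
  + move=> j; rewrite divr_ge0 ?(ltW (g0 j)) // mulmx_colB L1 subr_ge0.
    have [_ LS' _ _] := piv (Pnb j); exact: (conv_hull_half_space LS').
  + rewrite -[RHS]L1 [in RHS](ex x) mulmx_col_sum.
    by apply: eq_bigr => j _; rewrite TL1 mulr1.
- move=> xT; split => /=.
    apply: conv_hull_sub xT; first exact: cvx.
    by move=> _ [j _ <-]; apply: sub_conv_hull.
  apply/eqP; rewrite eq_le lE; apply/andP; split.
    rewrite -lE; apply: conv_hull_half_space xT => _ [j _ <-].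
    by rewrite lE TL1 mulr1.
  rewrite -lE -lerN2.
  have colN (z : 'rV_d.+1) : (z *m - l) 0 0 = - (z *m l) 0 0.
    by rewrite mulmxN; set Z := z *m l; rewrite mxE.
  rewrite -colN; apply: conv_hull_half_space xT => _ [j _ <-].
  by rewrite colN lE TL1 mulr1.
Qed.
End PivotFamily.

(** * Strict convexity of the superlevel sets of u cos x + v cos y *)

Lemma within_continuous_acos (R : realType) :
  {within `[(-1 : R), 1], continuous (@acos R)}.
Proof.
have := @segment_can_ge_continuous R 0 pi cos acos.
rewrite cos0 cospi; apply; first exact: pi_ge0.
- by apply: continuous_subspaceT => x; exact: continuous_cos.
- exact: cosK.
Qed.

(** This is the inverse of the continuous function y |-> (M - v cos y) / u, so
    continuity holds up to the end points. *)
Lemma within_continuous_acos_affine (R : realType) (u v M : R) : 0 < u -> 0 < v ->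
  {within `[(M - v) / u, (M + v) / u],
    continuous (fun C => acos ((M - u * C) / v))}.
Proof.
move=> u0 v0.
have := @segment_can_le_continuous R 0 pi (fun y => (M - v * cos y) / u)
  (fun C => acos ((M - u * C) / v)).
rewrite cos0 cospi mulr1 mulrN1 opprK; apply; first exact: pi_ge0.
- apply: continuous_subspaceT => x.
  apply: cvgM; last exact: cvg_cst.
  apply: cvgB; first exact: cvg_cst.
  apply: cvgM; first exact: cvg_cst.
  exact: continuous_cos.
- move=> y y0; have -> : (M - u * ((M - v * cos y) / u)) / v = cos y.
    by field; rewrite !gt_eqF.
  exact: cosK.
Qed.

(** On the curve u cos x + v cos y = M in the first quadrant, with C = cos x
    and E = cos y, the slope is governed by sin x / sin y, whose square is
    (1 - C^2) / (1 - E^2); this compares its values at C0 and at C.  The factor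
    k is positive because u, v, M satisfy the strict triangle inequalities,
    so that |v^2 - M^2 - u^2| < 2 M u, while |C0 + C| <= 1 + C0 C. *)
Lemma level_slope_mono (R : realFieldType) (u v M C0 C : R) :
  0 < u -> 0 < v -> u - v < M -> v - u < M -> M < u + v ->
  -1 < C -> C < 1 -> -1 <= C0 -> C0 <= 1 ->
  let E0 := (M - u * C0) / v in let E := (M - u * C) / v in
  exists2 k : R, 0 < k &
   (1 - E0 ^+ 2) * (1 - C ^+ 2) - (1 - C0 ^+ 2) * (1 - E ^+ 2) = k * (C0 - C).
Proof.
move=> u0 v0 M1 M2 M3 C1 C2 C01 C02 E0 E.
exists (((v ^+ 2 - M ^+ 2 - u ^+ 2) * (C0 + C) + 2 * M * u * (1 + C0 * C)) / v ^+ 2); last first.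
  by rewrite /E0 /E; field; rewrite gt_eqF.
rewrite divr_gt0 ?exprn_gt0 //.
have M0 : 0 < M by lra.
have h1 : 0 <= (1 - C0) * (1 - C) by rewrite mulr_ge0; lra.
have h2 : 0 <= (1 + C0) * (1 + C) by rewrite mulr_ge0; lra.
have h3 : 0 < 1 + C0 * C by nra.
have k1 : 0 < (v - M + u) * (v + M - u) by rewrite mulr_gt0; lra.
have k2 : 0 < (M + u - v) * (M + u + v) by rewrite mulr_gt0; lra.
have e1 : C0 + C <= 1 + C0 * C by lra.
have e2 : - (1 + C0 * C) <= C0 + C by lra.
set S := C0 + C in e1 e2 *; set P := 1 + C0 * C in h3 e1 e2 *.
have [S0|S0] := lerP 0 S; nra.
Qed.

(** Along the curve parametrized by C = cos x, the linear form defining the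
    tangent at C0 has a derivative with the sign of C0 - C, by the
    monotonicity of the slope; the mean value theorem concludes. *)
Lemma level_arc_below_tangent (R : realType) (u v M C0 C1 : R) :
  0 < u -> 0 < v -> u - v < M -> v - u < M -> M < u + v ->
  -1 <= C0 <= 1 -> -1 <= C1 <= 1 ->
  -1 <= (M - u * C0) / v <= 1 -> -1 <= (M - u * C1) / v <= 1 -> C1 != C0 ->
  u * sin (acos C0) * (acos C1 - acos C0)
   + v * sin (acos ((M - u * C0) / v))
       * (acos ((M - u * C1) / v) - acos ((M - u * C0) / v)) < 0.
Proof.
move=> u0 v0 M1 M2 M3 C0b C1b E0b E1b neq.
rewrite !sin_acos //.
set E := fun C => (M - u * C) / v; rewrite -/(E C0) -/(E C1) in E0b E1b *.
set K1 := u * Num.sqrt _; set K2 := v * Num.sqrt _.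
set Phi := fun C => K1 * acos C + K2 * acos (E C).
have Edec C C' : C < C' -> E C' < E C.
  by move=> CC'; rewrite ltr_pM2r ?invr_gt0 // ltrD2l ltrN2 ltr_pM2l.
set dPhi := fun C => K1 * - (Num.sqrt (1 - C ^+ 2))^-1
   + K2 * (u / v * (Num.sqrt (1 - E C ^+ 2))^-1).
have der C : -1 < C < 1 -> -1 < E C < 1 -> is_derive C 1 Phi (dPhi C).
  move=> Cb Eb.
  have dE : is_derive C (1:R) E (- (u / v)).
    apply: trigger_derive; rewrite /GRing.scale /=; ring.
  have d1 := @is_derive1_acos R C Cb; have d2 := @is_derive1_acos R _ Eb.
  have d3 := is_derive1_comp d2 dE.
  apply: is_derive_eq.
  rewrite /dPhi /GRing.scale /=; ring.
have cont a b : -1 <= a -> b <= 1 -> -1 <= E b -> E a <= 1 ->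
    {within `[a, b], continuous Phi}.
  move=> a1 b1 Eb Ea x.
  apply: cvgD; apply: cvgM; try exact: cvg_cst.
  - apply: (continuous_subspaceW _ (@within_continuous_acos R)) => z /=.
    by rewrite !in_itv /=; lra.
  - apply: (continuous_subspaceW _ (@within_continuous_acos_affine R u v M u0 v0)) => z /=.
    rewrite !in_itv /= ler_pdivrMr // ler_pdivlMr //.
    move: Ea Eb; rewrite /E ler_pdivrMr // ler_pdivlMr //; nra.
have sgn C : -1 < C < 1 -> -1 < E C < 1 -> exists2 k, 0 < k & dPhi C * k = C0 - C.
  move=> Cb Eb; have [[Cl Cr] [C0l C0r]] := (andP Cb, andP C0b).
  have [k k0 kE] := level_slope_mono u0 v0 M1 M2 M3 Cl Cr C0l C0r.
  have s1 : 0 < Num.sqrt (1 - C ^+ 2) by rewrite sqrtr_gt0; nra.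
  have s2 : 0 < Num.sqrt (1 - E C ^+ 2) by rewrite sqrtr_gt0; nra.
  have q1 : Num.sqrt (1 - C ^+ 2) ^+ 2 = 1 - C ^+ 2 by rewrite sqr_sqrtr //; nra.
  have q2 : Num.sqrt (1 - E C ^+ 2) ^+ 2 = 1 - E C ^+ 2 by rewrite sqr_sqrtr //; nra.
  have q3 : Num.sqrt (1 - C0 ^+ 2) ^+ 2 = 1 - C0 ^+ 2 by rewrite sqr_sqrtr //; nra.
  have q4 : Num.sqrt (1 - E C0 ^+ 2) ^+ 2 = 1 - E C0 ^+ 2 by rewrite sqr_sqrtr //; nra.
  rewrite /dPhi /K1 /K2; move: s1 s2 q1 q2 q3 q4.
  have p3 : 0 <= Num.sqrt (1 - C0 ^+ 2) := sqrtr_ge0 _.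
  have p4 : 0 <= Num.sqrt (1 - E C0 ^+ 2) := sqrtr_ge0 _.
  move: p3 p4.
  set a := Num.sqrt (1 - C ^+ 2); set b := Num.sqrt (1 - E C ^+ 2).
  set c := Num.sqrt (1 - C0 ^+ 2); set d := Num.sqrt (1 - E C0 ^+ 2).
  move=> p3 p4 s1 s2 q1 q2 q3 q4.
  have kE' : (d * a) ^+ 2 - (c * b) ^+ 2 = k * (C0 - C).
    by rewrite !exprMn q1 q2 q3 q4.
  have [z|z] := eqVneq (d * a + c * b) 0.
    (* Both products are nonnegative, so both vanish, which forces C = C0. *)
    exists 1 => //; have da : d * a = 0 by nra.
    have cb : c * b = 0 by nra.
    have ce0 : C0 - C = 0.
      apply: (mulfI (lt0r_neq0 k0)); rewrite -kE' da cb; ring.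
    have d0 : d = 0 by apply: (mulIf (lt0r_neq0 s1)); rewrite da mul0r.
    have c0 : c = 0 by apply: (mulIf (lt0r_neq0 s2)); rewrite cb mul0r.
    by rewrite ce0 d0 c0; ring.
  have zp : 0 < d * a + c * b by rewrite lt0r z /= addr_ge0 // mulr_ge0 // ltW.
  exists (a * b * (d * a + c * b) / (u * k)).
    by apply: divr_gt0; rewrite !mulr_gt0.
  have -> : C0 - C = ((d * a) ^+ 2 - (c * b) ^+ 2) / k.
    by rewrite kE'; field; rewrite gt_eqF.
  by field; rewrite !gt_eqF.
have -> : K1 * (acos C1 - acos C0) + K2 * (acos (E C1) - acos (E C0))
          = Phi C1 - Phi C0 by rewrite /Phi; ring.
have [lt|lt|eq] := ltgtP C1 C0; last by rewrite eq eqxx in neq.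
- have inI C : C \in `]C1, C0[ -> (-1 < C < 1) /\ (-1 < E C < 1).
    rewrite in_itv /= => /andP[h1 h2]; have := Edec _ _ h1; have := Edec _ _ h2; lra.
  have [||C Cin eq] := @MVT R Phi dPhi C1 C0 lt.
  + by move=> C /inI[h1 h2]; exact: der.
  + by apply: cont; lra.
  have [h1 h2] := inI _ Cin.
  have [k k0 kE] := sgn C h1 h2.
  move: Cin; rewrite in_itv /= => Cin.
  suff : 0 < dPhi C by nra.
  by rewrite -(pmulr_lgt0 _ k0) kE; lra.
- have inI C : C \in `]C0, C1[ -> (-1 < C < 1) /\ (-1 < E C < 1).
    rewrite in_itv /= => /andP[h1 h2]; have := Edec _ _ h1; have := Edec _ _ h2; lra.
  have [||C Cin eq] := @MVT R Phi dPhi C0 C1 lt.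
  + by move=> C /inI[h1 h2]; exact: der.
  + by apply: cont; lra.
  have [h1 h2] := inI _ Cin.
  have [k k0 kE] := sgn C h1 h2.
  move: Cin; rewrite in_itv /= => Cin.
  suff : dPhi C < 0 by nra.
  by rewrite -(pmulr_llt0 _ k0) kE; lra.
Qed.

(** Raising y until the point reaches the curve can only increase the linear
    form. *)
Lemma level_set_below_tangent_quadrant (R : realType) (u v M x0 y0 x y : R) :
  0 < u -> 0 < v -> u - v < M -> v - u < M -> M < u + v ->
  0 <= x0 <= pi -> 0 <= y0 <= pi -> 0 <= x <= pi -> 0 <= y <= pi ->
  u * cos x0 + v * cos y0 = M -> M <= u * cos x + v * cos y ->
  (x != x0) || (y != y0) ->
  u * sin x0 * (x - x0) + v * sin y0 * (y - y0) < 0.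
Proof.
move=> u0 v0 M1 M2 M3 x0b y0b xb yb onM geM neq.
have [cx1 cx2] := (cos_le1 x, cos_geN1 x).
have [cx01 cx02] := (cos_le1 x0, cos_geN1 x0).
have [cy1 cy2] := (cos_le1 y, cos_geN1 y).
have [cy01 cy02] := (cos_le1 y0, cos_geN1 y0).
have E0 : (M - u * cos x0) / v = cos y0 by rewrite -onM; field; rewrite gt_eqF.
have E1 : (M - u * cos x) / v <= cos y by rewrite ler_pdivrMr //; lra.
have E1' : -1 <= (M - u * cos x) / v by rewrite ler_pdivlMr //; nra.
have [eqC|neC] := eqVneq (cos x) (cos x0).
  have ex : x = x0 by apply: (@cos_inj R) => //; rewrite in_itv.
  move: neq; rewrite ex eqxx subrr mulr0 add0r /= => neq.
  have cy : cos y0 <= cos y by rewrite -E0 -eqC.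
  have yy0 : y < y0.
    rewrite lt_neqAle neq /= leNgt; apply/negP => lt.
    by move: cy; rewrite leNgt ltr_cos ?in_itv // lt.
  have y0pi : y0 < pi.
    rewrite lt_neqAle; case/andP: y0b => _ ->; rewrite andbT.
    by apply/eqP => e; move: onM; rewrite e cospi; nra.
  have s0 : 0 < sin y0 by apply: sin_gt0_pi; lra.
  have := mulr_gt0 v0 s0; nra.
have := @level_arc_below_tangent R u v M (cos x0) (cos x) u0 v0 M1 M2 M3.
rewrite E0 !cosK ?in_itv // => /(_ _ _ _ _ neC) h.
have E1b : -1 <= (M - u * cos x) / v <= 1 by rewrite E1' (le_trans E1).
have {}h := h ltac:(by rewrite cx01 cx02) ltac:(by rewrite cx1 cx2)
  ltac:(by rewrite cy01 cy02) E1b.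
have yle : y <= acos ((M - u * cos x) / v).
  rewrite leNgt; apply/negP => lt.
  have := lt; rewrite -ltr_cos ?in_itv //=; last by rewrite acos_ge0 // acos_lepi.
  by rewrite acosK ?in_itv //=; lra.
have sy : 0 <= v * sin y0 by apply: mulr_ge0; [lra | exact: sin_ge0_pi].
nra.
Qed.

Lemma sin_norm_mul_le (R : realType) (x0 x : R) : `|x0| <= pi ->
  sin x0 * x <= sin `|x0| * `|x|.
Proof.
move=> b; have : 0 <= sin `|x0| by rewrite sin_ge0_pi // normr_ge0.
case: (ger0P x0) => h s; have := ler_norm x; have := ler_norm (- x);
  rewrite normrN => h1 h2.
- by apply: ler_wpM2l.
- by move: s; rewrite sinN => s; nra.
Qed.

Lemma sin_norm_mul_id (R : realType) (x : R) : sin `|x| * `|x| = sin x * x.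
Proof. by case: (ger0P x) => h //; rewrite sinN; ring. Qed.

Lemma cos_norm (R : realType) (x : R) : cos `|x| = cos x.
Proof. by case: (ger0P x) => h //; rewrite cosN. Qed.

Lemma sin_norm_mul_lt (R : realType) (x0 x : R) : `|x0| < pi ->
  `|x| = `|x0| -> x != x0 -> sin x0 * x < sin x0 * x0.
Proof.
move=> b e ne; have : (x == x0) || (x == - x0) by rewrite -eqr_norm2 e.
rewrite (negbTE ne) /= => /eqP ex.
have x00 : 0 < `|x0|.
  by rewrite normr_gt0; apply: contraNneq ne => z; rewrite ex z oppr0.
have s : 0 < sin `|x0| by rewrite sin_gt0_pi // x00.
by have := sin_norm_mul_id x0; have := mulr_gt0 s x00; rewrite ex; nra.
Qed.

(** Reflecting both points into the first quadrant keeps the values of the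
    cosines and of the tangent form at (x0, y0), and cannot decrease it at
    (x, y). *)
Lemma level_set_below_tangent (R : realType) (u v M x0 y0 x y : R) :
  0 < u -> 0 < v -> u - v < M -> v - u < M -> M < u + v ->
  `|x0| <= pi -> `|y0| <= pi -> `|x| <= pi -> `|y| <= pi ->
  u * cos x0 + v * cos y0 = M -> M <= u * cos x + v * cos y ->
  (x != x0) || (y != y0) ->
  u * sin x0 * (x - x0) + v * sin y0 * (y - y0) < 0.
Proof.
move=> u0 v0 M1 M2 M3 x0b y0b xb yb onM geM neq.
have h1 := sin_norm_mul_le x x0b; have h2 := sin_norm_mul_le y y0b.
have i1 := sin_norm_mul_id x0; have i2 := sin_norm_mul_id y0.
have [eqn|neqn] := boolP ((`|x| == `|x0|) && (`|y| == `|y0|)).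
  case/andP: eqn => /eqP ex /eqP ey.
  have cy1 := cos_le1 y0; have cx1 := cos_le1 x0.
  have x0lt : `|x0| < pi.
    rewrite lt_neqAle x0b andbT; apply/eqP => e; move: onM.
    by rewrite -(cos_norm x0) e cospi; nra.
  have y0lt : `|y0| < pi.
    rewrite lt_neqAle y0b andbT; apply/eqP => e; move: onM.
    by rewrite -(cos_norm y0) e cospi; nra.
  rewrite ex i1 in h1; rewrite ey i2 in h2.
  case/orP: neq => ne.
  - by have := sin_norm_mul_lt x0lt ex ne; nra.
  - by have := sin_norm_mul_lt y0lt ey ne; nra.
have := @level_set_below_tangent_quadrant R u v M `|x0| `|y0| `|x| `|y|
  u0 v0 M1 M2 M3.
rewrite !normr_ge0 x0b y0b xb yb !cos_norm -negb_and neqn.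
move=> /(_ isT isT isT isT onM geM isT).
nra.
Qed.

(** The points are the i a + j b.  The tangent form at a + b is positive on a
    and on b, because b - a and a - b lie in the superlevel set, so on the
    cone i, j >= 1 it exceeds its value at the apex a + b, except at the apex
    itself. *)
Lemma level_set_avoids_cone (R : realType) (u v M a1 a2 b1 b2 i j : R) :
  0 < u -> 0 < v -> u - v < M -> v - u < M -> M < u + v ->
  `|a1| + `|b1| <= pi -> `|a2| + `|b2| <= pi -> a1 != 0 -> b1 != 0 ->
  u * cos (a1 + b1) + v * cos (a2 + b2) = M ->
  u * cos (a1 - b1) + v * cos (a2 - b2) = M ->
  1 <= i -> 1 <= j -> 2 < i + j ->
  `|i * a1 + j * b1| <= pi -> `|i * a2 + j * b2| <= pi ->
  u * cos (i * a1 + j * b1) + v * cos (i * a2 + j * b2) < M.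
Proof.
move=> u0 v0 M1 M2 M3 sq1 sq2 a10 b10 onp onm i1 j1 ij xb yb.
rewrite ltNge; apply/negP => geM.
have n1 := le_trans (ler_normD a1 b1) sq1; have n2 := le_trans (ler_normD a2 b2) sq2.
have n3 := le_trans (ler_normB a1 b1) sq1; have n4 := le_trans (ler_normB a2 b2) sq2.
have n3' : `|b1 - a1| <= pi by rewrite distrC.
have n4' : `|b2 - a2| <= pi by rewrite distrC.
have ne (a b : R) : a != 0 -> b - a != a + b.
  by apply: contra_neq => /eqP; clear; rewrite -subr_eq0 => /eqP; lra.
have onm' : M <= u * cos (b1 - a1) + v * cos (b2 - a2).
  by rewrite -(cosN (b1 - a1)) -(cosN (b2 - a2)) !opprB onm.
have tgt := @level_set_below_tangent R u v M (a1 + b1) (a2 + b2) _ _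
  u0 v0 M1 M2 M3 n1 n2.
(* Two of the other corners lie in the superlevel set, so the tangent
   form is positive on both sides of the parallelogram. *)
have t1 := tgt (b1 - a1) (b2 - a2) n3' n4' onp onm'.
have {}t1 := t1 ltac:(by rewrite ne).
have t2 := tgt (a1 - b1) (a2 - b2) n3 n4 onp ltac:(by rewrite onm).
have {}t2 := t2 ltac:(by rewrite (addrC a1 b1) ne).
have t3 := tgt _ _ xb yb onp geM.
move: (u * sin _) (v * sin _) t1 t2 t3 => s t t1 t2 t3.
clear - i1 j1 ij t1 t2 t3.
have p1 : 0 < s * a1 + t * a2 by lra.
have p2 : 0 < s * b1 + t * b2 by lra.
have pos : 0 < (i - 1) * (s * a1 + t * a2) + (j - 1) * (s * b1 + t * b2).
  have [i1'|i1'] := ltrP 1 i.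
  - by apply: ltr_wpDr; [apply: mulr_ge0 | apply: mulr_gt0];
      rewrite ?subr_ge0 ?subr_gt0 // ltW.
  - have j1' : 1 < j by lra.
    by apply: ltr_wpDl; [apply: mulr_ge0 | apply: mulr_gt0];
      rewrite ?subr_ge0 ?subr_gt0 // ltW.
case: eqVneq t3 => [ex|_] /=; last by move=> /(_ isT); clear - pos; lra.
case: eqVneq => [ey|_] /=; last by move=> /(_ isT); clear - pos; lra.
have : s * (i * a1 + j * b1) + t * (i * a2 + j * b2)
     = s * (a1 + b1) + t * (a2 + b2) by rewrite ex ey.
lra.
Qed.

(** Changing the signs of a and of b moves each of the four cones onto the
    cone i, j >= 1. *)
Lemma level_set_avoids_lattice (R : realType) (u v M a1 a2 b1 b2 i j : R) :
  0 < u -> 0 < v -> u - v < M -> v - u < M -> M < u + v ->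
  `|a1| + `|b1| <= pi -> `|a2| + `|b2| <= pi -> a1 != 0 -> b1 != 0 ->
  u * cos (a1 + b1) + v * cos (a2 + b2) = M ->
  u * cos (a1 - b1) + v * cos (a2 - b2) = M ->
  1 <= `|i| -> 1 <= `|j| -> 2 < `|i| + `|j| ->
  `|i * a1 + j * b1| <= pi -> `|i * a2 + j * b2| <= pi ->
  u * cos (i * a1 + j * b1) + v * cos (i * a2 + j * b2) < M.
Proof.
move=> u0 v0 M1 M2 M3.
wlog i0 : i a1 a2 / 0 <= i => [hw|].
  have [|i0 sq1 sq2 a10 b10 onp onm] := lerP 0 i; first exact: hw.
  have := hw (- i) (- a1) (- a2); rewrite !mulrNN !normrN oppr_eq0.
  apply=> //; first lra.
  - rewrite -(cosN (- a1 + _)) -(cosN (- a2 + _)) !opprD !opprK; exact: onm.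
  - rewrite -(cosN (- a1 - _)) -(cosN (- a2 - _)) !opprD !opprK; exact: onp.
wlog j0 : j b1 b2 / 0 <= j => [hw|].
  have [|j0 sq1 sq2 a10 b10 onp onm] := lerP 0 j; first exact: hw.
  have := hw (- j) (- b1) (- b2); rewrite !mulrNN !normrN oppr_eq0 !opprK.
  by apply=> //; lra.
move=> sq1 sq2 a10 b10 onp onm; rewrite (ger0_norm i0) (ger0_norm j0).
exact: level_set_avoids_cone.
Qed.

(** * The inequality |u - v| < M *)

Lemma tan_gt0_pihalf (R : realType) (x : R) : 0 < x < pi / 2 -> 0 < tan x.
Proof.
move=> xb; rewrite /tan divr_gt0 //; first exact: sin_gt0_pihalf.
by apply: cos_gt0_pihalf; lra.
Qed.

Lemma le_tan_pihalf (R : realType) (x y : R) : 0 <= x -> x <= y -> y < pi / 2 ->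
  tan x <= tan y.
Proof.
move=> x0; rewrite le_eqVlt => /predU1P[->//|xy] y1.
by rewrite ltW // ltr_tan ?in_itv /= ?xy //; have := @pi_gt0 R; lra.
Qed.

(** The addition formula for the tangent, used to pass from a to a + 1 in
    [tan_natmul_ratio]: p and P are the tangents of a x and a y. *)
Lemma tan_ratio_step (F : realFieldType) (t T p P : F) (A B : Prop) :
  0 < 1 - p * t -> 0 < 1 - P * T -> 0 < t -> t <= T -> 0 <= p -> p <= P ->
  p * T <= P * t -> (A -> 0 < p) -> (B -> t < T) ->
  (p + t) / (1 - p * t) * T <= (P + T) / (1 - P * T) * t /\
  (A -> B -> (p + t) / (1 - p * t) * T < (P + T) / (1 - P * T) * t).
Proof.
move=> d1 d2 t0 tT p0 pP pT pA tB.
have T0 : 0 < T by exact: lt_le_trans tT.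
have P0 : 0 <= P by exact: le_trans pP.
have e1 : p * t <= P * T by apply: ler_pM => //; exact: ltW.
have n0 : 0 <= p * T + t * T by rewrite -mulrDl; apply: mulr_ge0; lra.
have N0 : 0 < P * t + t * T.
  by apply: ltr_wpDl; [apply: mulr_ge0 => //; exact: ltW | exact: mulr_gt0].
have nN : p * T + t * T <= P * t + t * T by rewrite lerD2r.
rewrite !(mulrAC _ _^-1) [(p + t) * T]mulrDl [(P + T) * t]mulrDl (mulrC T t); split.
  apply: ler_pM => //; first by rewrite invr_ge0 ltW.
  by rewrite lef_pV2 ?posrE //; lra.
move=> /pA pp /tB tTp.
have lt' : p * t < P * T.
  apply: (@le_lt_trans _ _ (P * t)); first by rewrite ler_pM2r.
  by rewrite ltr_pM2l // (lt_le_trans pp).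
apply: (@le_lt_trans _ _ ((P * t + t * T) / (1 - p * t))).
  by rewrite ler_pM2r ?invr_gt0.
by rewrite ltr_pM2l // ltf_pV2 ?posrE //; lra.
Qed.

(** The ratio tan (a x) / tan x is increasing in x. *)
Lemma tan_natmul_ratio (R : realType) (x y : R) (a : nat) :
  0 < x -> x <= y -> a%:R * y < pi / 2 ->
  tan (a%:R * x) * tan y <= tan (a%:R * y) * tan x /\
  ((1 < a)%N -> x < y -> tan (a%:R * x) * tan y < tan (a%:R * y) * tan x).
Proof.
move=> x0 xy; elim: a => [|a IH] ay; first by rewrite !mul0r tan0 !mul0r; split.
have pi0 := @pi_gt0 R.
have a0 : 0 <= a%:R :> R by rewrite ler0n.
have nS : a.+1%:R = a%:R + 1 :> R by rewrite -addn1 natrD.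
rewrite nS !(mulrDl a%:R 1) !mul1r in ay *.
have axy : a%:R * x <= a%:R * y by rewrite ler_wpM2l.
have ax0 : 0 <= a%:R * x by rewrite mulr_ge0 ?(ltW x0).
have ay' : a%:R * y < pi / 2 by lra.
have [IH1 _] := IH ay'.
have y0 : 0 < y := lt_le_trans x0 xy.
have ay0 : 0 <= a%:R * y by rewrite mulr_ge0 ?(ltW y0).
have yl : y < pi / 2 by apply: le_lt_trans ay; rewrite lerDr.
have xl : x < pi / 2 := le_lt_trans xy yl.
have axl : a%:R * x < pi / 2 := le_lt_trans axy ay'.
have axSl : a%:R * x + x < pi / 2 by apply: le_lt_trans ay; rewrite lerD.
have cp (z : R) : 0 <= z -> z < pi / 2 -> 0 < cos z.
  move=> z0 zl; apply: cos_gt0_pihalf; rewrite zl andbT (lt_le_trans _ z0) //.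
  by rewrite oppr_lt0 divr_gt0.
have cx : 0 < cos x := cp _ (ltW x0) xl.
have cy : 0 < cos y := cp _ (ltW y0) yl.
have cax : 0 < cos (a%:R * x) := cp _ ax0 axl.
have cay : 0 < cos (a%:R * y) := cp _ ay0 ay'.
have cSx : 0 < cos (a%:R * x + x) by apply: cp => //; rewrite addr_ge0 ?(ltW x0).
have cSy : 0 < cos (a%:R * y + y) by apply: cp => //; rewrite addr_ge0 ?(ltW y0).
have tt (z w : R) : 0 < cos z -> 0 < cos w -> 0 < cos (z + w) -> 0 < 1 - tan z * tan w.
  move=> cz cw; rewrite cosD => czw.
  have -> : 1 - tan z * tan w = (cos z * cos w - sin z * sin w) / (cos z * cos w).
    by rewrite /tan; field; rewrite !gt_eqF.
  by apply: divr_gt0 => //; exact: mulr_gt0.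
have d1 := tt _ _ cax cx cSx; have d2 := tt _ _ cay cy cSy.
rewrite !tanD ?gt_eqF //.
have t0 : 0 < tan x by apply: tan_gt0_pihalf; rewrite x0.
have tT : tan x <= tan y by exact: le_tan_pihalf (ltW x0) xy yl.
have tau0 : 0 <= tan (a%:R * x) by rewrite -tan0; exact: le_tan_pihalf.
have tau : tan (a%:R * x) <= tan (a%:R * y) by exact: le_tan_pihalf.
have taup : (1 < a.+1)%N -> 0 < tan (a%:R * x).
  move=> a1; apply: tan_gt0_pihalf; rewrite axl andbT.
  by apply: mulr_gt0 => //; rewrite ltr0n -ltnS.
have tTp : x < y -> tan x < tan y.
  have npi : - (pi / 2) < 0 :> R by rewrite oppr_lt0 divr_gt0.
  by move=> lt; rewrite ltr_tan ?in_itv //= ?xl ?yl andbT (lt_trans npi).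
exact: tan_ratio_step.
Qed.

(** Since (b y) h is the complement of (a z) h, the factor tan (b h) is at
    most 1 / tan (a z h).  By [tan_natmul_ratio] the product of the two
    other factors is at most tan h tan (a z h), so the whole is at most
    tan h <= tan (y h).  One of the steps is strict unless y = 1 and one of
    a, z is 1. *)
Lemma tan_prod_lt (R : realType) (q a b y z : nat) (h : R) :
  (0 < a)%N -> (0 < b)%N -> (0 < y)%N -> (0 < z)%N ->
  (a * z + b * y = q)%N ->
  ~~ ((a == 1) && (y == 1))%N -> ~~ ((y == 1) && (z == 1))%N ->
  h = pi / (2 * q%:R) ->
  tan (a%:R * h) * tan (b%:R * h) * tan (z%:R * h) < tan (y%:R * h).
Proof.
move=> a0 b0 y0 z0 qE n1 n2 hE.
have q0N : (0 < q)%N by nia.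
have q1 : (1 < q)%N by nia.
have aq : (0 < a < q)%N by nia.
have bq : (0 < b < q)%N by nia.
have yq : (0 < y < q)%N by nia.
have zq : (0 < z < q)%N by nia.
have azq : (0 < a * z < q)%N by nia.
have byq : (b * y < q)%N by nia.
have b_by : (b <= b * y)%N by nia.
have strict : y = 1%N -> (1 < a)%N && (1 < z)%N.
  by move=> y1; move: n1 n2; rewrite y1; lia.
have y_gt1 : y != 1%N -> (1 < y)%N by lia.
move: qE n1 n2 => qE _ _.
have pi0 := @pi_gt0 R.
have q0 : 0 < q%:R :> R by rewrite ltr0n.
have h0 : 0 < h by rewrite hE; apply: divr_gt0 => //; apply: mulr_gt0.
have qh : q%:R * h = pi / 2 by rewrite hE; field; rewrite gt_eqF.
have lth n : (n < q)%N -> n%:R * h < pi / 2.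
  by move=> nq; rewrite -qh ltr_pM2r // ltr_nat.
have pos n : (0 < n)%N -> 0 < n%:R * h.
  by move=> n0; apply: mulr_gt0 => //; rewrite ltr0n.
have tpos n : (0 < n < q)%N -> 0 < tan (n%:R * h).
  by case/andP=> n0 nq; apply: tan_gt0_pihalf; rewrite pos // lth.
have h1 : h < pi / 2 by rewrite -[h]mul1r; apply: (lth 1%N).
have th0 : 0 < tan h by apply: tan_gt0_pihalf; rewrite h0 h1.
(* tan is increasing and b y h = pi / 2 - a z h. *)
have B : tan (b%:R * h) * tan ((a * z)%:R * h) <= 1.
  have oneE : tan ((b * y)%:R * h) * tan ((a * z)%:R * h) = 1.
    have -> : (b * y)%:R * h = pi / 2 - (a * z)%:R * h.
      by rewrite -qh -qE natrD; ring.
    rewrite /tan sinB cosB sin_pihalf cos_pihalf !mul0r !mul1r subr0 add0r.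
    case/andP: azq => az0 azq.
    have s0 : 0 < sin ((a * z)%:R * h).
      by apply: sin_gt0_pihalf; rewrite pos ?lth.
    have c0 : 0 < cos ((a * z)%:R * h).
      apply: cos_gt0_pihalf; rewrite lth // andbT.
      by apply: lt_trans (pos _ az0); rewrite oppr_lt0 divr_gt0.
    by field; rewrite !gt_eqF.
  rewrite -[leRHS]oneE ler_pM2r; last exact: tpos.
  case/andP: bq => _ bq.
  apply: le_tan_pihalf; [exact/ltW/pos| |exact: lth].
  by rewrite ler_pM2r // ler_nat.
have zh : h <= z%:R * h.
  by rewrite -{1}[h]mul1r ler_pM2r // (ler_nat _ 1).
have azE : a%:R * (z%:R * h) = (a * z)%:R * h by rewrite natrM; ring.
have azlt : a%:R * (z%:R * h) < pi / 2.
  by rewrite azE; apply: lth; case/andP: azq.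
have [D Ds] := @tan_natmul_ratio R h (z%:R * h) a h0 zh azlt.
rewrite azE in D Ds.
case/andP: yq => _ yq.
have yh : tan h <= tan (y%:R * h).
  apply: le_tan_pihalf; [exact: ltW| |exact: lth].
  by rewrite -{1}[h]mul1r ler_pM2r // (ler_nat _ 1).
have tb := tpos b bq; have taz := tpos (a * z)%N azq.
have e : tan (a%:R * h) * tan (b%:R * h) * tan (z%:R * h)
    = tan (b%:R * h) * (tan (a%:R * h) * tan (z%:R * h)) by ring.
have e3 : tan (b%:R * h) * (tan ((a * z)%:R * h) * tan h) <= tan h.
  by rewrite mulrA -[leRHS]mul1r ler_pM2r.
rewrite e; have [/strict/andP[a1 z1]|/y_gt1 y1] := eqVneq y 1%N.
  apply: lt_le_trans (le_trans e3 yh); rewrite ltr_pM2l //.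
  by apply: Ds => //; rewrite -{1}[h]mul1r ltr_pM2r // (ltr_nat _ 1).
apply: (@le_lt_trans _ _ (tan h)).
  by apply: le_trans e3; rewrite ler_pM2l.
have hy : h < y%:R * h by rewrite -{1}[h]mul1r ltr_pM2r // (ltr_nat _ 1).
have yl := lth y yq.
have npi : - (pi / 2) < 0 :> R by rewrite oppr_lt0 divr_gt0.
by rewrite ltr_tan // in_itv /= ?h1 ?yl andbT (lt_trans npi) // (lt_trans h0).
Qed.

(** With half angles, sin sin / (1 - cos cos) is twice r / (1 + r^2) for r the
    quotient of the tangents of Y and Z, and sin sin / (1 + cos cos) is the
    same function of the product of the tangents of A and B; the hypotheses
    say that the product is smaller than both r and 1 / r. *)
Lemma half_angle_gap (R : realType) (A B Y Z : R) :
  0 < A < pi / 2 -> 0 < B < pi / 2 -> 0 < Y < pi / 2 -> 0 < Z < pi / 2 ->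
  tan A * tan B * tan Z < tan Y -> tan A * tan B * tan Y < tan Z ->
  sin (2 * A) * sin (2 * B) * (1 - cos (2 * Y) * cos (2 * Z)) <
  sin (2 * Y) * sin (2 * Z) * (1 + cos (2 * A) * cos (2 * B)).
Proof.
move=> Ab Bb Yb Zb.
have sA := sin_gt0_pihalf Ab; have sB := sin_gt0_pihalf Bb.
have sY := sin_gt0_pihalf Yb; have sZ := sin_gt0_pihalf Zb.
have cA : 0 < cos A by apply: cos_gt0_pihalf; lra.
have cB : 0 < cos B by apply: cos_gt0_pihalf; lra.
have cY : 0 < cos Y by apply: cos_gt0_pihalf; lra.
have cZ : 0 < cos Z by apply: cos_gt0_pihalf; lra.
have S x : sin (2 * x) = 2 * sin x * cos x.
  by rewrite mulr_natl sin_mulr2n -mulr_natl; ring.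
have C x : cos (2 * x) = cos x ^+ 2 - sin x ^+ 2.
  by rewrite mulr_natl mulr2n cosD; ring.
rewrite !S !C.
have qA := cos2Dsin2 A; have qB := cos2Dsin2 B.
have qY := cos2Dsin2 Y; have qZ := cos2Dsin2 Z.
rewrite /tan.
move: sA sB sY sZ cA cB cY cZ qA qB qY qZ.
set a := sin A; set b := sin B; set y := sin Y; set z := sin Z.
set a' := cos A; set b' := cos B; set y' := cos Y; set z' := cos Z.
move=> sA sB sY sZ cA cB cY cZ qA qB qY qZ h1 h2.
have D0 : 0 < a' * b' * z' * y' by rewrite pmulr_lgt0 // pmulr_lgt0 // pmulr_lgt0.
have {h1} : a * b * z * y' < a' * b' * z' * y.
  have -> : a * b * z * y' = (a / a' * (b / b') * (z / z')) * (a' * b' * z' * y').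
    by field; rewrite !gt_eqF.
  have -> : a' * b' * z' * y = y / y' * (a' * b' * z' * y').
    by field; rewrite !gt_eqF.
  by rewrite ltr_pM2r.
have {h2} : a * b * y * z' < a' * b' * y' * z.
  have -> : a * b * y * z' = (a / a' * (b / b') * (y / y')) * (a' * b' * z' * y').
    by field; rewrite !gt_eqF.
  have -> : a' * b' * y' * z = z / z' * (a' * b' * z' * y').
    by field; rewrite !gt_eqF.
  by rewrite ltr_pM2r.
move=> h1 h2.
have -> : 1 - (y' ^+ 2 - y ^+ 2) * (z' ^+ 2 - z ^+ 2)
    = 2 * (y ^+ 2 * z' ^+ 2 + y' ^+ 2 * z ^+ 2).
  by rewrite -[1]mulr1 -{1}qY -{1}qZ; ring.
have -> : 1 + (a' ^+ 2 - a ^+ 2) * (b' ^+ 2 - b ^+ 2)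
    = 2 * (a ^+ 2 * b ^+ 2 + a' ^+ 2 * b' ^+ 2).
  by rewrite -[1]mulr1 -{1}qA -{1}qB; ring.
rewrite -subr_gt0.
have -> : 2 * y * y' * (2 * z * z') * (2 * (a ^+ 2 * b ^+ 2 + a' ^+ 2 * b' ^+ 2))
  - 2 * a * a' * (2 * b * b') * (2 * (y ^+ 2 * z' ^+ 2 + y' ^+ 2 * z ^+ 2))
  = 8 * ((a' * b' * y' * z - a * b * y * z') * (a' * b' * z' * y - a * b * z * y')).
  by ring.
by rewrite mulr_gt0 // mulr_gt0 // subr_gt0.
Qed.

(** * Admissible pairs as lattice bases *)

(** The fractions alpha/a < p/q < beta/b, encoded by the lattice vectors (a, y)
    and (b, -z) of determinant q.  The fractions are 0 and 1 when a = b = 1,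
    and are both Farey neighbours of p/q when y = z = 1. *)
Definition oriented_pair (q p a b y z alpha beta : nat) : bool :=
  [&& (0 < a)%N, (0 < b)%N, (0 < y)%N, (0 < z)%N,
      (a * z + b * y == q)%N,
      ~~ ((a == 1) && (b == 1))%N, ~~ ((y == 1) && (z == 1))%N,
      (p * a == y + alpha * q)%N & (p * b + z == beta * q)%N].

(** A pair of denominators, without recording which fraction is the smaller
    one. *)
Definition tet_pair (q p a b : nat) : Prop :=
  exists y z alpha beta,
    oriented_pair q p a b y z alpha beta \/ oriented_pair q p b a y z alpha beta.

Definition vertex (n : int) (a b : nat) (j : 'I_4) : int :=
  n + [:: 0; a%:Z; b%:Z; a%:Z + b%:Z]`_j.

(** Since the orbit has period q, vertices are compared modulo q. *)
Definition in_tet (q : nat) (n : int) (a b : nat) (k : int) : Prop :=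
  exists (j : 'I_4) (m : int), k = vertex n a b j + m * q%:Z.

Lemma exists_centered_rep (N : int) (q : nat) : (0 < q)%N ->
  exists m : int, - q%:Z <= N + 2 * q%:Z * m <= q%:Z.
Proof.
move=> q0; exists (- ((N + q%:Z) %/ (2 * q%:Z))%Z).
have h1 := divz_eq (N + q%:Z) (2 * q%:Z).
have h2 : 0 <= ((N + q%:Z) %% (2 * q%:Z))%Z by apply: modz_ge0; lia.
have h3 : ((N + q%:Z) %% (2 * q%:Z))%Z < 2 * q%:Z by apply: ltz_pmod; lia.
lia.
Qed.

(** The point k of the orbit is moved into the square [-q, q]^2 (in half
    units) and written in the basis (a, y), (b, -z).  Its coordinates i, j come
    out odd, because the center of the parallelogram is half the sum of the
    basis vectors; both are 1 in absolute value only at the corners. *)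
Lemma lattice_representative (q p a b y z alpha beta : nat) (k : int) :
  oriented_pair q p a b y z alpha beta -> ~ in_tet q 0 a b k ->
  exists i j m1 m2 : int,
    [/\ 2 * k - a%:Z - b%:Z + 2 * q%:Z * m1 = i * a%:Z + j * b%:Z,
        2 * p%:Z * k - y%:Z + z%:Z + 2 * q%:Z * m2 = i * y%:Z - j * z%:Z,
        1 <= `|i| , 1 <= `|j| & 2 < `|i| + `|j|] /\
    `|i * a%:Z + j * b%:Z| <= q%:Z /\ `|i * y%:Z - j * z%:Z| <= q%:Z.
Proof.
case/and5P=> a0 b0 y0 z0 /and5P[/eqP qE _ _ /eqP pa /eqP pb] notin.
have q0 : (0 < q)%N by nia.
have [m1 Xb] := exists_centered_rep (2 * k - a%:Z - b%:Z) q0.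
have [m2 Yb] := exists_centered_rep (2 * p%:Z * k - y%:Z + z%:Z) q0.
have qZ : a%:Z * z%:Z + b%:Z * y%:Z = q%:Z by rewrite -qE; lia.
have paZ : p%:Z * a%:Z = y%:Z + alpha%:Z * q%:Z by lia.
have pbZ : p%:Z * b%:Z = beta%:Z * q%:Z - z%:Z by lia.
pose i := 2 * (k * beta%:Z + m1 * z%:Z + m2 * b%:Z) - 1.
pose j := 2 * (- (k * alpha%:Z) + m1 * y%:Z - m2 * a%:Z) - 1.
have EX : 2 * k - a%:Z - b%:Z + 2 * q%:Z * m1 = i * a%:Z + j * b%:Z.
  apply: (@mulIf _ q%:Z); first by lia.
  have -> : (i * a%:Z + j * b%:Z) * q%:Z =
     2 * k * (a%:Z * (beta%:Z * q%:Z) - b%:Z * (alpha%:Z * q%:Z))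
     - (a%:Z + b%:Z) * q%:Z
     + 2 * q%:Z * m1 * (a%:Z * z%:Z + b%:Z * y%:Z) by rewrite /i /j; ring.
  have -> : alpha%:Z * q%:Z = p%:Z * a%:Z - y%:Z by rewrite paZ; ring.
  have -> : beta%:Z * q%:Z = p%:Z * b%:Z + z%:Z by rewrite pbZ; ring.
  by rewrite -qZ; ring.
have EY : 2 * p%:Z * k - y%:Z + z%:Z + 2 * q%:Z * m2 = i * y%:Z - j * z%:Z.
  apply: (@mulIf _ q%:Z); first by lia.
  have -> : (i * y%:Z - j * z%:Z) * q%:Z =
     2 * k * (y%:Z * (beta%:Z * q%:Z) + z%:Z * (alpha%:Z * q%:Z))
     - (y%:Z - z%:Z) * q%:Z
     + 2 * q%:Z * m2 * (a%:Z * z%:Z + b%:Z * y%:Z) by rewrite /i /j; ring.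
  have -> : alpha%:Z * q%:Z = p%:Z * a%:Z - y%:Z by rewrite paZ; ring.
  have -> : beta%:Z * q%:Z = p%:Z * b%:Z + z%:Z by rewrite pbZ; ring.
  by rewrite -qZ; ring.
exists i, j, m1, m2; rewrite -EX -EY; split; last by split; lia.
have i_odd : exists i', i = 2 * i' - 1 by rewrite /i; eexists.
have j_odd : exists j', j = 2 * j' - 1 by rewrite /j; eexists.
case: i_odd => i' iE; case: j_odd => j' jE.
split=> //; [lia|lia|].
suff: ~ (`|i| = 1 /\ `|j| = 1) by lia.
case=> i1 j1; apply: notin.
have kE : 2 * k = a%:Z + b%:Z + i * a%:Z + j * b%:Z - 2 * q%:Z * m1 by lia.
have [ei|ei] : i = 1 \/ i = -1 by lia.
- have [ej|ej] : j = 1 \/ j = -1 by lia.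
  + by exists (inord 3), (- m1); rewrite /vertex inordK //=; rewrite ei ej in kE; lia.
  + by exists (inord 1), (- m1); rewrite /vertex inordK //=; rewrite ei ej in kE; lia.
- have [ej|ej] : j = 1 \/ j = -1 by lia.
  + by exists (inord 2), (- m1); rewrite /vertex inordK //=; rewrite ei ej in kE; lia.
  + by exists (inord 0), (- m1); rewrite /vertex inordK //=; rewrite ei ej in kE; lia.
Qed.

(** u - v < M and v - u < M come from two instances of [half_angle_gap], which
    differ by exchanging the roles of the two coordinates; the four bounds on
    tangents that they need are instances of [tan_prod_lt].  The cases a = y = 1 and
    b = z = 1 are excluded by 2 <= p <= q - 2. *)
Lemma oriented_pair_gap (R : realType) (q p a b y z alpha beta : nat) :
  (2 <= p <= q - 2)%N -> oriented_pair q p a b y z alpha beta ->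
  let t n : R := pi * n%:R / q%:R in
  let u := sin (t y) * sin (t z) in let v := sin (t a) * sin (t b) in
  let M := u * (cos (t a) * cos (t b)) + v * (cos (t y) * cos (t z)) in
  [/\ 0 < u, 0 < v & [/\ u - v < M, v - u < M & M < u + v]].
Proof.
move=> hp /and5P[a0 b0 y0 z0 /and5P[/eqP qE n1 n2 /eqP pa /eqP pb]] t u v M.
have n3 : ~~ ((a == 1) && (y == 1))%N.
  apply/negP=> /andP[/eqP ea /eqP ey]; rewrite ea ey in pa.
  have : (alpha = 0 \/ 1 <= alpha)%N by lia.
  by case=> h; nia.
have n4 : ~~ ((b == 1) && (z == 1))%N.
  apply/negP=> /andP[/eqP ea /eqP ey]; rewrite ea ey in pb.
  have : (beta = 0 \/ beta = 1 \/ 2 <= beta)%N by lia.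
  by case=> [h|[h|h]]; nia.
have q0N : (0 < q)%N by nia.
have [aq bq yq zq] : [/\ (a < q)%N, (b < q)%N, (y < q)%N & (z < q)%N].
  have := leq_pmulr a z0; have := leq_pmull z a0.
  by have := leq_pmulr b y0; have := leq_pmull y b0; split; lia.
have E1 : (b * y + a * z = q)%N by rewrite addnC.
have E2 : (y * b + z * a = q)%N by rewrite (mulnC y) (mulnC z).
have E3 : (z * a + y * b = q)%N by rewrite addnC.
have n1' : ~~ ((b == 1) && (a == 1))%N by rewrite andbC.
have n2' : ~~ ((z == 1) && (y == 1))%N by rewrite andbC.
have n3' : ~~ ((y == 1) && (a == 1))%N by rewrite andbC.
have n4' : ~~ ((z == 1) && (b == 1))%N by rewrite andbC.
have q0 : 0 < q%:R :> R by rewrite ltr0n.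
have pi0 := @pi_gt0 R.
pose h : R := pi / (2 * q%:R).
have T1 := @tan_prod_lt R q a b y z h a0 b0 y0 z0 qE n3 n2 erefl.
have T2 := @tan_prod_lt R q b a z y h b0 a0 z0 y0 E1 n4 n2' erefl.
have T3 := @tan_prod_lt R q y z a b h y0 z0 a0 b0 E2 n3' n1 erefl.
have T4 := @tan_prod_lt R q z y b a h z0 y0 b0 a0 E3 n4' n1' erefl.
have hb n : (0 < n)%N -> (n < q)%N -> 0 < n%:R * h < pi / 2.
  move=> n0 nq; have -> : pi / 2 = q%:R * h by rewrite /h; field; rewrite gt_eqF.
  have h0 : 0 < h by rewrite divr_gt0 // mulr_gt0.
  by rewrite pmulr_lgt0 // ltr0n n0 ltr_pM2r // ltr_nat.
have tE n : t n = 2 * (n%:R * h) by rewrite /t /h; field; rewrite gt_eqF.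
have ts n : (0 < n)%N -> (n < q)%N -> 0 < sin (t n).
  by move=> n0 nq; apply: sin_gt0_pi; have := hb n n0 nq; rewrite tE; lra.
have G1 := @half_angle_gap R _ _ _ _ (hb a a0 aq) (hb b b0 bq) (hb y y0 yq) (hb z z0 zq) T1.
have {}G1 := G1 ltac:(by move: T2; rewrite (mulrC (tan (b%:R * h)))).
have G2 := @half_angle_gap R _ _ _ _ (hb y y0 yq) (hb z z0 zq) (hb a a0 aq) (hb b b0 bq) T3.
have {}G2 := G2 ltac:(by move: T4; rewrite (mulrC (tan (z%:R * h)))).
rewrite -!tE -/u -/v in G1 G2.
have u0 : 0 < u by apply: mulr_gt0; exact: ts.
have v0 : 0 < v by apply: mulr_gt0; exact: ts.
have cc m n : (0 < m < q)%N -> (0 < n < q)%N -> cos (t m) * cos (t n) < 1.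
  case/andP=> m0 mq /andP[n0 nq].
  have s1 := ts m m0 mq; have s2 := ts n n0 nq.
  have := cos2Dsin2 (t m); have := cos2Dsin2 (t n); nra.
have c1 := cc a b ltac:(by rewrite a0) ltac:(by rewrite b0).
have c2 := cc y z ltac:(by rewrite y0) ltac:(by rewrite z0).
have k1 : u * (cos (t a) * cos (t b)) < u by rewrite gtr_pMr.
have k2 : v * (cos (t y) * cos (t z)) < v by rewrite gtr_pMr.
split=> //; rewrite /M; clearbody u v.
move: (cos (t a) * cos (t b)) (cos (t y) * cos (t z)) G1 G2 k1 k2.
by clear => c d *; split; lra.
Qed.

(** * The supporting functionals *)

Lemma cosD2pi_int (R : realType) (x : R) (m : int) :
  cos (x + 2 * pi * m%:~R) = cos x.
Proof.
have E (n : nat) y : cos (y + 2 * pi * n%:R) = cos y :> R.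
  elim: n => [|n IH]; first by rewrite mulr0 addr0.
  rewrite -[in RHS]IH -[n.+1%:R]natr1 mulrDr mulr1 addrA.
  by rewrite -(cosD2pi (y + _)); congr cos; rewrite mulr2n; ring.
case: m => n; first exact: E.
rewrite -[RHS](E n.+1) -(E n.+1 (x + _)) NegzE mulrNz.
have := E n.+1 x; rewrite /intmul => {}E'.
by rewrite E' mulrN subrK.
Qed.

Lemma cosDpi_nat (R : realType) (x : R) (m : nat) :
  cos (x + pi * m%:R) = (-1) ^+ m * cos x.
Proof.
elim: m x => [|m IH] x; first by rewrite mulr0 addr0 mul1r.
by rewrite -[m.+1%:R]natr1 mulrDr mulr1 addrA cosDpi IH exprS; ring.
Qed.

Lemma sinDpi_nat (R : realType) (x : R) (m : nat) :
  sin (x + pi * m%:R) = (-1) ^+ m * sin x.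
Proof.
elim: m x => [|m IH] x; first by rewrite mulr0 addr0 mul1r.
by rewrite -[m.+1%:R]natr1 mulrDr mulr1 addrA sinDpi IH exprS; ring.
Qed.

(** The combination of the two frequencies, centered at (a + b) / 2, that takes
    the same value at 0, a, b and a + b. *)
Definition wave (R : realType) (q p a b : nat) (t : R) : R :=
  sin (pi * (p * a)%:R / q%:R) * sin (pi * (p * b)%:R / q%:R)
    * cos (pi * (2 * t - a%:R - b%:R) / q%:R)
  - sin (pi * a%:R / q%:R) * sin (pi * b%:R / q%:R)
    * cos (p%:R * (pi * (2 * t - a%:R - b%:R) / q%:R)).

Lemma wave_sym (R : realType) (q p a b : nat) : @wave R q p a b =1 wave q p b a.
Proof.
move=> t; rewrite /wave -!(addrAC _ (- b%:R)).
by congr (_ * _ - _ * _); rewrite mulrC.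
Qed.

(** Replacing p a by y and p b by - z costs multiples of pi, which contribute
    one common sign. *)
Lemma oriented_waveE (R : realType) (q p a b y z alpha beta : nat) (k : int) :
  oriented_pair q p a b y z alpha beta ->
  @wave R q p a b k%:~R = - (-1) ^+ (alpha + beta) *
    (sin (pi * y%:R / q%:R) * sin (pi * z%:R / q%:R)
       * cos (pi * (2 * k - a%:Z - b%:Z)%:~R / q%:R)
   + sin (pi * a%:R / q%:R) * sin (pi * b%:R / q%:R)
       * cos (pi * (2 * p%:Z * k - y%:Z + z%:Z)%:~R / q%:R)).
Proof.
move=> /and5P[a0 b0 y0 z0 /and5P[/eqP qE n1 n2 /eqP pa /eqP pb]].
have q0 : q%:R != 0 :> R by rewrite pnatr_eq0; nia.
have paR : p%:R * a%:R = y%:R + alpha%:R * q%:R :> R.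
  by rewrite -!natrM -natrD pa.
have pbR : p%:R * b%:R = beta%:R * q%:R - z%:R :> R.
  by rewrite -!natrM -pb natrD addrK.
rewrite /wave pa natrD natrM.
have -> : (p * b)%:R = beta%:R * q%:R - z%:R :> R by rewrite natrM.
have -> : pi * (y%:R + alpha%:R * q%:R) / q%:R
   = pi * y%:R / q%:R + pi * alpha%:R :> R by field.
have -> : pi * (beta%:R * q%:R - z%:R) / q%:R
   = - (pi * z%:R / q%:R) + pi * beta%:R :> R by field.
rewrite !sinDpi_nat sinN.
have e : (2 * p%:Z * k - y%:Z + z%:Z)%:~R
    = p%:R * (2 * k%:~R - a%:R - b%:R) + q%:R * (alpha + beta)%:R :> R.
  rewrite !rmorphD !rmorphN !rmorphM /= mulrBr mulrBr paR pbR ?natrD; ring.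
have -> : pi * (2 * p%:Z * k - y%:Z + z%:Z)%:~R / q%:R
    = p%:R * (pi * (2 * k%:~R - a%:R - b%:R) / q%:R) + pi * (alpha + beta)%:R :> R.
  by rewrite e; field.
rewrite cosDpi_nat.
have -> : (2 * k - a%:Z - b%:Z)%:~R = 2 * k%:~R - a%:R - b%:R :> R.
  by rewrite !rmorphD !rmorphN !rmorphM.
have s2 : (-1) ^+ (alpha + beta) * (-1) ^+ (alpha + beta) = 1 :> R.
  by rewrite -expr2 sqrr_sign.
rewrite exprD in s2 *.
move: s2; set s := _ ^+ alpha; set r := _ ^+ beta => s2.
set C := cos (p%:R * _); set X := cos _; set S1 := sin _; set S2 := sin _.
set S3 := sin _; set S4 := sin _.
rewrite mulrDr; congr (_ + _); first by ring.
have -> : - (s * r) * (S3 * S4 * (s * r * C)) = - ((s * r) * (s * r)) * (S3 * S4 * C).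
  by ring.
by rewrite s2; ring.
Qed.

Lemma oriented_wave_lt (R : realType) (q p a b y z alpha beta : nat) :
  (2 <= p <= q - 2)%N -> oriented_pair q p a b y z alpha beta ->
  wave q p a b 0 != 0 :> R /\
  forall k : int,
    (in_tet q 0 a b k -> wave q p a b k%:~R / wave q p a b 0 = 1 :> R) /\
    (~ in_tet q 0 a b k -> wave q p a b k%:~R / wave q p a b 0 < 1 :> R).
Proof.
move=> hp H.
have /and5P[a0 b0 y0 z0 /and5P[/eqP qE n1 n2 /eqP pa /eqP pb]] := H.
have q0N : (0 < q)%N by rewrite -qE addn_gt0 muln_gt0 a0 z0.
have paZ : p%:Z * a%:Z = y%:Z + alpha%:Z * q%:Z by rewrite -!PoszM -PoszD pa.
have pbZ : p%:Z * b%:Z = beta%:Z * q%:Z - z%:Z.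
  by rewrite -!PoszM -pb PoszD addrK.
have [u0 v0 [M1 M2 M3]] := @oriented_pair_gap R _ _ _ _ _ _ _ _ hp H.
have wE := fun k => @oriented_waveE R q p a b y z alpha beta k H.
have q0 : 0 < q%:R :> R by rewrite ltr0n.
have qn : q%:R != 0 :> R by rewrite gt_eqF.
have abq : (a + b <= q)%N by rewrite -qE leq_add // leq_pmulr.
have yzq : (y + z <= q)%N by rewrite -qE addnC leq_add // leq_pmull.
have pi0 := @pi_gt0 R.
move: u0 v0 M1 M2 M3.
set u := sin _ * sin _; set v := sin _ * sin _.
set M := u * _ + v * _.
move=> u0 v0 M1 M2 M3.
pose s : R := (-1) ^+ (alpha + beta).
have s2 : s * s = 1 by rewrite /s -expr2 sqrr_sign.
have sn : s != 0 by rewrite /s signr_eq0.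
have M0 : 0 < M by lra.
have onp : u * cos (pi * a%:R / q%:R + pi * b%:R / q%:R)
   + v * cos (pi * y%:R / q%:R + - (pi * z%:R / q%:R)) = M.
  by rewrite !cosD sinN cosN /M /u /v; ring.
have onm : u * cos (pi * a%:R / q%:R - pi * b%:R / q%:R)
   + v * cos (pi * y%:R / q%:R - - (pi * z%:R / q%:R)) = M.
  by rewrite opprK !cosD sinN cosN /M /u /v; ring.
pose g (k : int) : R := u * cos (pi * (2 * k - a%:Z - b%:Z)%:~R / q%:R)
  + v * cos (pi * (2 * p%:Z * k - y%:Z + z%:Z)%:~R / q%:R).
have gM (k m1 m2 i j : int) :
  2 * k - a%:Z - b%:Z + 2 * q%:Z * m1 = i * a%:Z + j * b%:Z ->
  2 * p%:Z * k - y%:Z + z%:Z + 2 * q%:Z * m2 = i * y%:Z - j * z%:Z ->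
  g k = u * cos (i%:~R * (pi * a%:R / q%:R) + j%:~R * (pi * b%:R / q%:R))
      + v * cos (i%:~R * (pi * y%:R / q%:R) + j%:~R * - (pi * z%:R / q%:R)).
  move=> e1 e2; rewrite /g.
  have {}e1 : (2 * k - a%:Z - b%:Z)%:~R = i%:~R * a%:R + j%:~R * b%:R - 2 * q%:R * m1%:~R :> R.
    have -> : 2 * k - a%:Z - b%:Z = i * a%:Z + j * b%:Z - 2 * q%:Z * m1.
      by rewrite -e1; ring.
    by rewrite !rmorphD !rmorphN !rmorphM.
  have {}e2 : (2 * p%:Z * k - y%:Z + z%:Z)%:~R
     = i%:~R * y%:R - j%:~R * z%:R - 2 * q%:R * m2%:~R :> R.
    have -> : 2 * p%:Z * k - y%:Z + z%:Z = i * y%:Z - j * z%:Z - 2 * q%:Z * m2.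
      by rewrite -e2; ring.
    by rewrite !rmorphD !rmorphN !rmorphM.
  rewrite e1 e2 -[cos (pi * _ / _)](cosD2pi_int _ m1).
  rewrite -[X in v * X](cosD2pi_int _ m2).
  by congr (u * cos _ + v * cos _); field.
have g0 : g 0 = M.
  rewrite -onp (gM 0 0 0 (-1) (-1)); [|ring|ring].
  by rewrite -(cosN (_ + _)) -[X in v * X]cosN; congr (u * cos _ + v * cos _); ring.
have w0 : wave q p a b 0 = - s * M by rewrite -g0; exact: (wE 0).
have ratio k : wave q p a b k%:~R / wave q p a b 0 = g k / M.
  by rewrite w0 wE -/s -/(g k); field; rewrite sn gt_eqF.
split; first by rewrite w0 mulf_neq0 ?oppr_eq0 // gt_eqF.
move=> k; rewrite ratio; split.
- case=> j [m kE].
  suff -> : g k = M by rewrite divff // gt_eqF.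
  move: kE; case: j => -[|[|[|[|//]]]] ? /=; rewrite /vertex /= => kE.
  + rewrite -g0 (gM k (- m) (- p%:Z * m) (-1) (-1)); [|rewrite kE; ring..].
    by rewrite (gM 0 0 0 (-1) (-1)); [|ring..].
  + rewrite -onm (gM k (- m) (- p%:Z * m - alpha%:Z) 1 (-1)).
    * by congr (u * cos _ + v * cos _); ring.
    * by rewrite kE; ring.
    * have -> : 2 * p%:Z * k = 2 * (p%:Z * a%:Z) + 2 * p%:Z * m * q%:Z.
        by rewrite kE; ring.
      by rewrite paZ; ring.
  + rewrite -onm (gM k (- m) (- p%:Z * m - beta%:Z) (-1) 1).
    * rewrite -(cosN (_ + _)) -[X in v * X]cosN.
      by congr (u * cos _ + v * cos _); ring.
    * by rewrite kE; ring.
    * have -> : 2 * p%:Z * k = 2 * (p%:Z * b%:Z) + 2 * p%:Z * m * q%:Z.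
        by rewrite kE; ring.
      by rewrite pbZ; ring.
  + rewrite -onp (gM k (- m) (- p%:Z * m - alpha%:Z - beta%:Z) 1 1).
    * by congr (u * cos _ + v * cos _); ring.
    * by rewrite kE; ring.
    * have -> : 2 * p%:Z * k = 2 * (p%:Z * a%:Z) + 2 * (p%:Z * b%:Z) + 2 * p%:Z * m * q%:Z.
        by rewrite kE; ring.
      by rewrite paZ pbZ; ring.
- move=> notin; rewrite ltr_pdivrMr // mul1r.
  have [i [j [m1 [m2 [[e1 e2 i1 j1 ij] [Xb Yb]]]]]] := lattice_representative H notin.
  rewrite (gM _ _ _ _ _ e1 e2).
  have pos n : 0 <= pi * n%:R / q%:R :> R by rewrite divr_ge0 // mulr_ge0 // ltW.
  have nz n : (0 < n)%N -> pi * n%:R / q%:R != 0 :> R.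
    by move=> n0; rewrite !mulf_neq0 ?invr_eq0 ?(gt_eqF pi0) // pnatr_eq0 -lt0n.
  have sum m n : (m + n <= q)%N -> pi * m%:R / q%:R + pi * n%:R / q%:R <= pi :> R.
    by move=> mn; rewrite -mulrDl -mulrDr ler_pdivrMr // ler_pM2l // -natrD ler_nat.
  have bnd (N : int) : `|N| <= q%:Z -> `|pi * N%:~R / q%:R| <= pi :> R.
    move=> Nq; rewrite !normrM normfV (gtr0_norm pi0) (gtr0_norm q0).
    by rewrite ler_pdivrMr // ler_pM2l // -intr_norm (ler_int _ _ q).
  apply: level_set_avoids_lattice => //; rewrite ?oppr_eq0 ?nz //.
  + by rewrite !ger0_norm // sum.
  + by rewrite normrN !ger0_norm // sum.
  + by rewrite -intr_norm (ler_int R 1).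
  + by rewrite -intr_norm (ler_int R 1).
  + by rewrite -!intr_norm -rmorphD (ltr_int R 2).
  + have -> : i%:~R * (pi * a%:R / q%:R) + j%:~R * (pi * b%:R / q%:R)
       = pi * (i * a%:Z + j * b%:Z)%:~R / q%:R :> R.
      by rewrite rmorphD !rmorphM /=; field.
    exact: bnd.
  + have -> : i%:~R * (pi * y%:R / q%:R) + j%:~R * - (pi * z%:R / q%:R)
       = pi * (i * y%:Z - j * z%:Z)%:~R / q%:R :> R.
      by rewrite rmorphB !rmorphM /=; field.
    exact: bnd.
Qed.

Lemma expiD (R : realType) (s t : R) : expi (s + t) = expi s * expi t.
Proof.
apply/eqP; rewrite eq_complex /= cosD sinD eqxx /=; apply/eqP; ring.
Qed.

Lemma orbit_pointE (R : realType) (q p : nat) (k : int) :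
  orbit_point R q p k = (expi (2 * pi / q%:R * k%:~R),
                         expi (2 * p%:R * pi / q%:R * k%:~R)).
Proof.
have E0 : expi (0 : R) = 1 by rewrite /expi cos0 sin0.
have PE m (t : R) : t * (Posz m)%:~R = t * m%:R by [].
case: k => n; rewrite /orbit_point; first rewrite !PE.
  elim: n => [|n IH]; first by rewrite !mulr0 E0.
  rewrite iterS IH /phi /= -!expiD; congr (expi _, expi _);
    by rewrite -[n.+1%:R]natr1; ring.
have NE m (t : R) : t * (Negz m)%:~R = - (t * m.+1%:R).
  by rewrite NegzE mulrNz mulrN.
rewrite !NE.
have inv (s t : R) : expi s / expi t = expi (s - t).
  by apply: (canLR (mulfK (expi_neq0 t))); rewrite -expiD subrK.
elim: n.+1 => [|m IH]; first by rewrite !mulr0 oppr0 E0.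
rewrite iterS IH /phi_inv /= !inv; congr (expi _, expi _);
  by rewrite -[m.+1%:R]natr1; ring.
Qed.

Lemma xptE (R : realType) (q p : nat) (k : int) :
  let t : R := 2 * pi / q%:R * k%:~R in
  xpt R q p k = \row_j [:: cos t; sin t; cos (p%:R * t); sin (p%:R * t)]`_j.
Proof.
move=> t; rewrite /xpt orbit_pointE /C2_to_R4 /expi /=.
by have -> : 2 * p%:R * pi / q%:R * k%:~R = p%:R * t by rewrite /t; ring.
Qed.

Lemma xpt_periodic (R : realType) (q p : nat) (k m : int) : (0 < q)%N ->
  xpt R q p (k + m * q%:Z) = xpt R q p k.
Proof.
move=> q0; have qn : q%:R != 0 :> R by rewrite pnatr_eq0 -lt0n.
have sinP (x : R) (h : int) : sin (x + 2 * pi * h%:~R) = sin x.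
  by rewrite -!cosBpihalf addrAC cosD2pi_int.
rewrite !xptE.
have -> : 2 * pi / q%:R * (k + m * q%:Z)%:~R
   = 2 * pi / q%:R * k%:~R + 2 * pi * m%:~R :> R.
  by rewrite rmorphD rmorphM /=; field.
rewrite (mulrDr p%:R) (_ : p%:R * (2 * pi * m%:~R) = 2 * pi * (p%:Z * m)%:~R); last first.
  by rewrite rmorphM /=; ring.
by rewrite !cosD2pi_int !sinP.
Qed.

(** The functional whose value at x_k is wave (k - n) / wave 0, obtained by
    expanding the cosines of a sum with the phase d. *)
Definition support_functional (R : realType) (q p a b : nat) (n : int) : 'cV[R]_4 :=
  let d : R := - (pi * (2 * n%:~R + a%:R + b%:R) / q%:R) in
  let U : R := sin (pi * (p * a)%:R / q%:R) * sin (pi * (p * b)%:R / q%:R) in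
  let V : R := - (sin (pi * a%:R / q%:R) * sin (pi * b%:R / q%:R)) in
  \col_j ([:: U * cos d; - (U * sin d); V * cos (p%:R * d);
              - (V * sin (p%:R * d))]`_j / wave q p a b 0).

Lemma xpt_support_functional (R : realType) (q p a b : nat) (n k : int) :
  (xpt R q p k *m support_functional R q p a b n) 0 0
  = wave q p a b (k - n)%:~R / wave q p a b 0.
Proof.
rewrite xptE mxE !big_ord_recl big_ord0 !mxE /=.
set w := wave _ _ _ _ 0.
rewrite /wave rmorphB /=.
have -> : pi * (2 * (k%:~R - n%:~R) - a%:R - b%:R) / q%:R
  = 2 * pi / q%:R * k%:~R + - (pi * (2 * n%:~R + a%:R + b%:R) / q%:R) :> R.
  by ring.
by rewrite (mulrDr p%:R) !cosD; ring.
Qed.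

Lemma in_tet_shift (q : nat) (n : int) (a b : nat) (k : int) :
  in_tet q n a b k <-> in_tet q 0 a b (k - n).
Proof.
by split=> -[j [m kE]]; exists j, m; move: kE; rewrite /vertex; lia.
Qed.

Lemma in_tet_sym (q : nat) (n : int) (a b : nat) (k : int) :
  in_tet q n a b k -> in_tet q n b a k.
Proof.
case=> j [m ->]; case: j => -[|[|[|[|//]]]] ?.
- by exists (inord 0), m; rewrite /vertex inordK.
- by exists (inord 2), m; rewrite /vertex inordK.
- by exists (inord 1), m; rewrite /vertex inordK.
- by exists (inord 3), m; rewrite /vertex inordK //= (addrC a%:Z).
Qed.

Lemma in_tet_mod (q : nat) (n h : int) (a b : nat) (k : int) :
  in_tet q (n + h * q%:Z) a b k <-> in_tet q n a b k.
Proof.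
split=> -[j [m ->]].
- by exists j, (m + h); rewrite /vertex; ring.
- by exists j, (m - h); rewrite /vertex; ring.
Qed.

Lemma support_functional_le1 (R : realType) (q p a b : nat) (n k : int) :
  (2 <= p <= q - 2)%N -> tet_pair q p a b ->
  (in_tet q n a b k -> (xpt R q p k *m support_functional R q p a b n) 0 0 = 1) /\
  (~ in_tet q n a b k -> (xpt R q p k *m support_functional R q p a b n) 0 0 < 1).
Proof.
move=> hp [y [z [al [be [H|H]]]]]; rewrite xpt_support_functional in_tet_shift.
- by have [_ /(_ (k - n))] := @oriented_wave_lt R _ _ _ _ _ _ _ _ hp H.
- have [_ /(_ (k - n)) [h1 h2]] := @oriented_wave_lt R _ _ _ _ _ _ _ _ hp H.
  rewrite !(wave_sym _ _ a b); split.
  + by move/in_tet_sym; exact: h1.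
  + by move=> notin; apply: h2 => /in_tet_sym.
Qed.

(** * Neighbours of the tetrahedra *)

(** Complex conjugation of the second coordinate exchanges p and q - p; it
    reverses the order of the fractions, hence swaps a and b. *)
Lemma oriented_pair_flip (q p a b y z al be : nat) : (p <= q)%N ->
  oriented_pair q p a b y z al be ->
  oriented_pair q (q - p) b a z y (b - be) (a - al).
Proof.
move=> pq /and5P[a0 b0 y0 z0 /and5P[/eqP qE n1 n2 /eqP pa /eqP pb]].
have zq : (z < q)%N by have := leq_pmull z a0; have := leq_pmulr b y0; lia.
have beb : (be <= b)%N.
  have : (be * q < (b + 1) * q)%N by have := leq_mul pq (leqnn b); lia.
  by rewrite ltn_mul2r; lia.
have ala : (al <= a)%N.
  have : (al * q < (a + 1) * q)%N by have := leq_mul pq (leqnn a); lia.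
  by rewrite ltn_mul2r; lia.
apply/and5P; split=> //; apply/and5P; split.
- by rewrite addnC; apply/eqP.
- by rewrite andbC.
- by rewrite andbC.
- by rewrite !mulnBl; have := leq_mul pq (leqnn b); have := leq_mul beb (leqnn q); lia.
- by rewrite !mulnBl; have := leq_mul pq (leqnn a); have := leq_mul ala (leqnn q); lia.
Qed.

Lemma tet_pair_flip (q p a b : nat) : (p <= q)%N ->
  tet_pair q (q - p) a b -> tet_pair q p a b.
Proof.
move=> pq [y [z [al [be H]]]].
have pq' : (q - p <= q)%N by lia.
by case: H => /(oriented_pair_flip pq'); rewrite (subKn pq) => H;
  eexists _, _, _, _; [right|left]; exact: H.
Qed.

Lemma small_not_multiple (q : nat) (d m : int) :
  d != 0 -> `|d| < q%:Z -> d <> m * q%:Z.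
Proof.
move=> d0 dq dE; move: dq d0; rewrite dE.
have [->|m0] := eqVneq m 0; first by rewrite mul0r eqxx.
rewrite normrM; have : 1 <= `|m| by lia.
by nia.
Qed.

Lemma not_in_tet (q : nat) (n : int) (a b : nat) (k : int) :
  (forall j, k - vertex n a b j != 0 /\ `|k - vertex n a b j| < q%:Z) ->
  ~ in_tet q n a b k.
Proof.
move=> H [j [m kE]]; have [h1 h2] := H j.
by apply: (small_not_multiple h1 h2 (m := m)); rewrite kE; ring.
Qed.

Definition pivot_at (q p a b : nat) (n : int) (j : 'I_4) : Prop :=
  exists (n' : int) (a' b' : nat),
    [/\ tet_pair q p a' b',
        forall k, k != j -> in_tet q n' a' b' (vertex n a b k)
      & ~ in_tet q n' a' b' (vertex n a b j)].

(** If y = z the lattice contains (a + b, 0), so q divides a + b, and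
    q = y (a + b) leaves only y = z = 1; likewise for a = b. *)
Lemma oriented_pair_neq (q p a b y z al be : nat) : coprime p q ->
  oriented_pair q p a b y z al be -> y != z /\ a != b.
Proof.
move=> pq /and5P[a0 b0 y0 z0 /and5P[/eqP qE n1 n2 /eqP pa /eqP pb]].
have qp : coprime q p by rewrite coprime_sym.
split; apply/eqP => e.
- have dab : (q %| a + b)%N.
    rewrite -(Gauss_dvdr _ qp) mulnDr.
    have -> : (p * a + p * b = (al + be) * q)%N by lia.
    exact: dvdn_mull.
  have := dvdn_leq _ dab; rewrite addn_gt0 a0 => /(_ isT).
  have y1 : (1 < y)%N by lia.
  by have := leq_mul (leqnn (a + b)) y1; move: qE; rewrite -e -mulnDl; lia.
- have dyz : (q %| y + z)%N.
    rewrite (_ : (y + z = (be - al) * q)%N); first exact: dvdn_mull.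
    by rewrite mulnBl; lia.
  have := dvdn_leq _ dyz; rewrite addn_gt0 y0 => /(_ isT).
  have a1 : (1 < a)%N by lia.
  by have := leq_mul a1 (leqnn (y + z)); move: qE; rewrite -e -mulnDr; lia.
Qed.

Lemma ord4P (Q : 'I_4 -> Prop) :
  Q (inord 0) -> Q (inord 1) -> Q (inord 2) -> Q (inord 3) -> forall j, Q j.
Proof.
move=> Q0 Q1 Q2 Q3 j; rewrite -(inord_val j).
by case: j => -[|[|[|[|//]]]] ?.
Qed.

Lemma vertex_inord (n : int) (a b : nat) :
  [/\ vertex n a b (inord 0) = n, vertex n a b (inord 1) = n + a%:Z,
      vertex n a b (inord 2) = n + b%:Z & vertex n a b (inord 3) = n + a%:Z + b%:Z].
Proof. by split; rewrite /vertex inordK //= ?addr0 ?addrA. Qed.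

Lemma in_tet_inord (q : nat) (n : int) (a b : nat) (k m : int) :
  [\/ k = n + m * q%:Z, k = n + a%:Z + m * q%:Z, k = n + b%:Z + m * q%:Z
    | k = n + a%:Z + b%:Z + m * q%:Z] -> in_tet q n a b k.
Proof.
have [v0 v1 v2 v3] := vertex_inord n a b.
by case=> ->; [exists (inord 0)|exists (inord 1)|exists (inord 2)|exists (inord 3)];
  exists m; rewrite ?v0 ?v1 ?v2 ?v3.
Qed.

Lemma not_in_tet_inord (q : nat) (n : int) (a b : nat) (k : int) :
  [/\ k != n, k != n + a%:Z, k != n + b%:Z & k != n + a%:Z + b%:Z] ->
  [/\ `|k - n| < q%:Z, `|k - (n + a%:Z)| < q%:Z, `|k - (n + b%:Z)| < q%:Z
    & `|k - (n + a%:Z + b%:Z)| < q%:Z] -> ~ in_tet q n a b k.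
Proof.
have [v0 v1 v2 v3] := vertex_inord n a b.
move=> [h0 h1 h2 h3] [l0 l1 l2 l3]; apply: not_in_tet.
by apply: ord4P; rewrite ?v0 ?v1 ?v2 ?v3 subr_eq0.
Qed.

Lemma pivot_atI (q p a b : nat) (n : int) (j : nat) (n' : int) (a' b' : nat) :
  (j < 4)%N -> tet_pair q p a' b' ->
  (forall k, (k < 4)%N -> k != j ->
     in_tet q n' a' b' (vertex n a b (inord k))) ->
  ~ in_tet q n' a' b' (vertex n a b (inord j)) ->
  pivot_at q p a b n (inord j).
Proof.
move=> j4 tp inT notin; exists n', a', b'; split=> // k kj.
rewrite -(inord_val k); apply: inT => //.
by apply: contraNneq kj => e; rewrite -e inord_val.
Qed.

(** The new pair is (a + b, y - z), (b, -z), whose parallelograms based at n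
    and at n - b share three vertices with the old one.  If it is excluded,
    that is if y = 2 and z = 1, then a = - 2 b modulo q: the vertices are four
    consecutive terms of an arithmetic progression of step b, and the
    neighbours are the translates by b and - b. *)
Lemma oriented_pivot_down (q p a b y z al be : nat) (n : int) : (5 <= q)%N ->
  coprime p q -> oriented_pair q p a b y z al be -> (z < y)%N ->
  pivot_at q p a b n (inord 1) /\ pivot_at q p a b n (inord 2).
Proof.
move=> q5 pq H zy; have [_ ab] := oriented_pair_neq pq H.
have /and5P[a0 b0 y0 z0 /and5P[/eqP qE n1 n2 /eqP pa /eqP pb]] := H.
have [v0 v1 v2 v3] := vertex_inord n a b.
have az := leq_pmulr a z0.
have by2 : (b * 2 <= b * y)%N by rewrite leq_mul2l; lia.
have [/andP[/eqP yz1 /eqP z1]|yz] := boolP ((y - z == 1) && (z == 1))%N.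
- have {}qE : (a + b * 2 = q)%N by rewrite -qE z1 (_ : y = 2%N) ?muln1 //; lia.
  have a2b : a != (b * 2)%N.
    apply/eqP => e; have : (b %| z)%N.
      rewrite -(dvdn_addr _ (dvdn_mull p (dvdnn b))) pb -qE e dvdn_mull //.
      by rewrite dvdn_add // dvdn_mulr.
    by rewrite z1 dvdn1 => /eqP b1; move: qE q5; rewrite e b1; lia.
  have tp : tet_pair q p a b by exists y, z, al, be; left.
  split.
  + apply: (@pivot_atI _ _ _ _ _ _ (n + b%:Z) a b) => //.
    * move=> [|[|[|[|//]]]] // _ _; rewrite ?v0 ?v2 ?v3.
      - by apply: (@in_tet_inord _ _ _ _ _ (-1)); constructor 4; lia.
      - by apply: (@in_tet_inord _ _ _ _ _ 0); constructor 1; lia.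
      - by apply: (@in_tet_inord _ _ _ _ _ 0); constructor 2; lia.
    * by rewrite v1; apply: not_in_tet_inord; split; lia.
  + apply: (@pivot_atI _ _ _ _ _ _ (n - b%:Z) a b) => //.
    * move=> [|[|[|[|//]]]] // _ _; rewrite ?v0 ?v1 ?v3.
      - by apply: (@in_tet_inord _ _ _ _ _ 0); constructor 3; lia.
      - by apply: (@in_tet_inord _ _ _ _ _ 0); constructor 4; lia.
      - by apply: (@in_tet_inord _ _ _ _ _ 1); constructor 1; lia.
    * by rewrite v2; apply: not_in_tet_inord; split; lia.
- have tp : tet_pair q p (a + b) b.
    exists (y - z)%N, z, (al + be)%N, be; left.
    have bz : (b * z <= b * y)%N by rewrite leq_mul2l; lia.
    apply/and5P; split; [lia|lia|lia|lia|apply/and5P; split].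
    + by rewrite mulnDl mulnBr; lia.
    + lia.
    + exact: yz.
    + by rewrite mulnDr mulnDl; lia.
    + exact/eqP.
  have by2' : (b * 2 < q)%N by lia.
  split.
  + apply: (@pivot_atI _ _ _ _ _ _ n (a + b) b) => //.
    * move=> [|[|[|[|//]]]] // _ _; rewrite ?v0 ?v2 ?v3.
      - by apply: (@in_tet_inord _ _ _ _ _ 0); constructor 1; lia.
      - by apply: (@in_tet_inord _ _ _ _ _ 0); constructor 3; lia.
      - by apply: (@in_tet_inord _ _ _ _ _ 0); constructor 2; lia.
    * by rewrite v1; apply: not_in_tet_inord; split; lia.
  + apply: (@pivot_atI _ _ _ _ _ _ (n - b%:Z) (a + b) b) => //.
    * move=> [|[|[|[|//]]]] // _ _; rewrite ?v0 ?v1 ?v3.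
      - by apply: (@in_tet_inord _ _ _ _ _ 0); constructor 3; lia.
      - by apply: (@in_tet_inord _ _ _ _ _ 0); constructor 2; lia.
      - by apply: (@in_tet_inord _ _ _ _ _ 0); constructor 4; lia.
    * by rewrite v2; apply: not_in_tet_inord; split; lia.
Qed.

(** The new pair is (a - b, y + z), (b, -z), whose parallelograms based at n
    and at n + b share three vertices with the old one.  If it is excluded,
    that is if a = 2 and b = 1, the vertices are n, n + 1, n + 2, n + 3. *)
Lemma oriented_pivot_up (q p a b y z al be : nat) (n : int) : (5 <= q)%N ->
  (p <= q)%N -> oriented_pair q p a b y z al be -> (b < a)%N ->
  pivot_at q p a b n (inord 0) /\ pivot_at q p a b n (inord 3).
Proof.
move=> q5 pq H ba.
have /and5P[a0 b0 y0 z0 /and5P[/eqP qE n1 n2 /eqP pa /eqP pb]] := H.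
have [v0 v1 v2 v3] := vertex_inord n a b.
have az := leq_pmulr a z0; have by1 := leq_pmulr b y0.
have abq : (a + b < q)%N.
  have [z1|z1] := ltnP 1 z.
    by have := leq_mul (leqnn a) z1; lia.
  by have := @leq_mul b 2 b y (leqnn b); lia.
have [/andP[/eqP ab1 /eqP b1]|nab] := boolP ((a - b == 1) && (b == 1))%N.
- have tp : tet_pair q p a b by exists y, z, al, be; left.
  have a2 : a = 2%N by lia.
  move: v0 v1 v2 v3; rewrite a2 b1 in tp * => v0 v1 v2 v3; split.
  + apply: (@pivot_atI _ _ _ _ _ _ (n + 1) 2 1) => //.
    * move=> [|[|[|[|//]]]] // _ _; rewrite ?v1 ?v2 ?v3.
      - by apply: (@in_tet_inord _ _ _ _ _ 0); constructor 3; lia.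
      - by apply: (@in_tet_inord _ _ _ _ _ 0); constructor 1; lia.
      - by apply: (@in_tet_inord _ _ _ _ _ 0); constructor 2; lia.
    * by rewrite v0; apply: not_in_tet_inord; split; lia.
  + apply: (@pivot_atI _ _ _ _ _ _ (n - 1) 2 1) => //.
    * move=> [|[|[|[|//]]]] // _ _; rewrite ?v0 ?v1 ?v2.
      - by apply: (@in_tet_inord _ _ _ _ _ 0); constructor 3; lia.
      - by apply: (@in_tet_inord _ _ _ _ _ 0); constructor 4; lia.
      - by apply: (@in_tet_inord _ _ _ _ _ 0); constructor 2; lia.
    * by rewrite v3; apply: not_in_tet_inord; split; lia.
- have yzq : (y + z < q)%N.
    have := leq_pmull z a0; have : (b * y + 2 * z <= q)%N.
      by have := @leq_mul 2 z a z; lia.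
    by have := leq_pmull y b0; lia.
  have beal : (be <= al)%N.
    have : (be * q < (al + 1) * q)%N.
      have := leq_mul (leqnn p) (ltnW ba); rewrite mulnDl mul1n; lia.
    by rewrite ltn_mul2r; lia.
  have tp : tet_pair q p (a - b) b.
    exists (y + z)%N, z, (al - be)%N, be; left.
    have bz : (b * z <= a * z)%N by rewrite leq_mul2r; lia.
    have pba : (p * b <= p * a)%N by rewrite leq_mul2l; lia.
    have beq : (be * q <= al * q)%N by rewrite leq_mul2r; lia.
    apply/and5P; split; [lia|lia|lia|lia|apply/and5P; split].
    + by rewrite mulnBl mulnDr; lia.
    + exact: nab.
    + lia.
    + by rewrite mulnBr mulnBl; lia.
    + exact/eqP.
  split.
  + apply: (@pivot_atI _ _ _ _ _ _ (n + b%:Z) (a - b) b) => //.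
    * move=> [|[|[|[|//]]]] // _ _; rewrite ?v1 ?v2 ?v3.
      - by apply: (@in_tet_inord _ _ _ _ _ 0); constructor 2; lia.
      - by apply: (@in_tet_inord _ _ _ _ _ 0); constructor 1; lia.
      - by apply: (@in_tet_inord _ _ _ _ _ 0); constructor 4; lia.
    * by rewrite v0; apply: not_in_tet_inord; split; lia.
  + apply: (@pivot_atI _ _ _ _ _ _ n (a - b) b) => //.
    * move=> [|[|[|[|//]]]] // _ _; rewrite ?v0 ?v1 ?v2.
      - by apply: (@in_tet_inord _ _ _ _ _ 0); constructor 1; lia.
      - by apply: (@in_tet_inord _ _ _ _ _ 0); constructor 4; lia.
      - by apply: (@in_tet_inord _ _ _ _ _ 0); constructor 3; lia.
    * by rewrite v3; apply: not_in_tet_inord; split; lia.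
Qed.

Lemma pivot_at_swap (q p a b : nat) (n : int) (j : nat) : (j < 4)%N ->
  pivot_at q p a b n (inord j) ->
  pivot_at q p b a n (inord (nth 0%N [:: 0; 2; 1; 3]%N j)).
Proof.
move=> j4 [n' [a' [b' [tp inT notin]]]]; exists n', a', b'.
have [v0 v1 v2 v3] := vertex_inord n a b; have [w0 w1 w2 w3] := vertex_inord n b a.
have w3' : vertex n b a (inord 3) = vertex n a b (inord 3) by rewrite v3 w3; lia.
have w2' : vertex n b a (inord 2) = vertex n a b (inord 1) by rewrite v1 w2.
have w1' : vertex n b a (inord 1) = vertex n a b (inord 2) by rewrite v2 w1.
have w0' : vertex n b a (inord 0) = vertex n a b (inord 0) by rewrite v0 w0.
split=> //.
  move: j4 inT {notin}; case: j => [|[|[|[|//]]]] _ inT /=; apply: ord4P;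
    rewrite ?eqxx // => kj; rewrite ?w0' ?w1' ?w2' ?w3'; apply: inT;
    by rewrite -val_eqE /= !inordK.
by move: j4 notin {inT}; case: j => [|[|[|[|//]]]] _ /=;
  rewrite ?w0' ?w1' ?w2' ?w3'.
Qed.

Lemma pivot_at_flip (q p a b : nat) (n : int) (j : 'I_4) : (p <= q)%N ->
  pivot_at q (q - p) a b n j -> pivot_at q p a b n j.
Proof.
by move=> pq [n' [a' [b' [tp H1 H2]]]]; exists n', a', b'; split=> //; exact: tet_pair_flip.
Qed.

(** The cases y < z and a < b are reduced to the previous ones by exchanging p
    and q - p. *)
Lemma oriented_pivot (q p a b y z al be : nat) (n : int) : (5 <= q)%N ->
  (p <= q)%N -> coprime p q -> oriented_pair q p a b y z al be ->
  forall j, pivot_at q p a b n j.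
Proof.
move=> q5 pq cop H; have [yz ab] := oriented_pair_neq cop H.
have H' := oriented_pair_flip pq H.
have pq' : (q - p <= q)%N by lia.
have cop' : coprime (q - p) q 
  by rewrite /coprime -{2}(subnK pq) gcdnDl gcdnC -gcdnDr subnK.
have [D1 D2] : pivot_at q p a b n (inord 1) /\ pivot_at q p a b n (inord 2).
  have [lt|lt|e] := ltngtP y z; last by rewrite e eqxx in yz.
    have [h1 h2] := oriented_pivot_down n q5 cop' H' lt.
    by split; [apply: (@pivot_at_swap _ _ b a n 2) | apply: (@pivot_at_swap _ _ b a n 1)];
      rewrite //; apply: pivot_at_flip.
  exact: (oriented_pivot_down n q5 cop H lt).
have [U0 U3] : pivot_at q p a b n (inord 0) /\ pivot_at q p a b n (inord 3).
  have [lt|lt|e] := ltngtP a b; last by rewrite e eqxx in ab.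
    have [h1 h2] := oriented_pivot_up n q5 pq' H' lt.
    by split; [apply: (@pivot_at_swap _ _ b a n 0) | apply: (@pivot_at_swap _ _ b a n 3)];
      rewrite //; apply: pivot_at_flip.
  exact: (oriented_pivot_up n q5 pq H lt).
exact: ord4P.
Qed.

Lemma tet_pivot (q p a b : nat) (n : int) (j : 'I_4) : (5 <= q)%N ->
  (p <= q)%N -> coprime p q -> tet_pair q p a b -> pivot_at q p a b n j.
Proof.
move=> q5 pq cop [y [z [al [be [H|H]]]]]; first exact: (oriented_pivot _ q5 pq cop H).
have P := oriented_pivot n q5 pq cop H.
by move: j; apply: ord4P;
  [apply: (@pivot_at_swap _ _ b a n 0) | apply: (@pivot_at_swap _ _ b a n 2)
  |apply: (@pivot_at_swap _ _ b a n 1) | apply: (@pivot_at_swap _ _ b a n 3)].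
Qed.

(** The pair {0, 1} is excluded, so its child on the side of p / q is taken. *)
Lemma tet_pair_exists (q p : nat) : (5 <= q)%N -> (2 <= p <= q - 2)%N ->
  coprime p q -> exists a b, tet_pair q p a b.
Proof.
move=> q5 hp cop; have [lt|lt|e] := ltngtP p (q - p).
- exists 1%N, 2%N; exists p, (q - 2 * p)%N, 0%N, 1%N; left.
  by apply/and5P; split; [lia|lia|lia|lia|apply/and5P; split; lia].
- exists 2%N, 1%N; exists (2 * p - q)%N, (q - p)%N, 1%N, 1%N; left.
  by apply/and5P; split; [lia|lia|lia|lia|apply/and5P; split; lia].
- have q2 : q = (2 * p)%N by lia.
  by move: cop; rewrite q2 /coprime gcdnMl => /eqP; lia.
Qed.

Lemma tet_pair_lt (q p a b : nat) : tet_pair q p a b -> (a < q)%N && (b < q)%N.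
Proof.
suff H c d y z al be : oriented_pair q p c d y z al be -> (c < q)%N && (d < q)%N.
  by case=> y [z [al [be [/H|/H]]]] //; rewrite andbC.
move=> /and5P[c0 d0 y0 z0 /and5P[/eqP qE n1 n2 /eqP pa /eqP pb]].
have := leq_pmulr c z0; have := leq_pmulr d y0; lia.
Qed.

Lemma admissible_sym (Q A B : rat) : admissible Q A B -> admissible Q B A.
Proof.
case=> h1 [h2 [h3 [h4 [h5 h6]]]]; split=> //; split=> //; split; last first.
  split; first by case: h4; [right|left].
  by split=> -[x y]; [apply: h5 | apply: h6].
by move: h3; rewrite /farey_neighbors /= -normrN opprB.
Qed.

Lemma reduced_denq (n d : nat) : (0 < d)%N -> coprime n d ->
  numq (n%:Q / d%:Q) = n /\ denq (n%:Q / d%:Q) = d.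
Proof.
move=> d0 cop; split.
- by rewrite coprimeq_num //= gtr0_sg ?mul1r.
- by rewrite coprimeq_den //= ifN ?gt_eqF //; case: d d0 {cop}.
Qed.

(** The determinant q of the basis gives a beta - b alpha = 1, so the fractions
    are reduced and are Farey neighbours; y and z are the determinants of each
    fraction with p / q. *)
Lemma oriented_pair_admissible (q p a b y z al be : nat) :
  (2 <= p <= q - 2)%N -> coprime p q -> oriented_pair q p a b y z al be ->
  exists A B : rat, [/\ admissible (p%:Q / q%:Q) A B, denq A = a & denq B = b].
Proof.
move=> hp cop /and5P[a0 b0 y0 z0 /and5P[/eqP qE n1 n2 /eqP pa /eqP pb]].
have q0 : (0 < q)%N by lia.
have zq : (z < q)%N by have := leq_pmull z a0; have := leq_pmulr b y0; lia.
have det : (a * be = b * al + 1)%N.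
  suff : (a * be * q = (b * al + 1) * q)%N by move/eqP; rewrite eqn_pmul2r // => /eqP.
  have e1 : (a * (p * b + z) = a * (be * q))%N by rewrite pb.
  have e2 : (b * (p * a) = b * (y + al * q))%N by rewrite pa.
  lia.
have copA : coprime al a.
  rewrite /coprime -dvdn1 -(dvdn_addr 1 (dvdn_mull b (dvdn_gcdl al a))) -det.
  by rewrite dvdn_mulr // dvdn_gcdr.
have copB : coprime be b.
  rewrite /coprime -dvdn1 -(dvdn_addr 1 (dvdn_mulr al (dvdn_gcdr be b))) -det.
  by rewrite dvdn_mull // dvdn_gcdl.
have [nA dA] := reduced_denq a0 copA.
have [nB dB] := reduced_denq b0 copB.
have [nQ dQ] := reduced_denq q0 cop.
have alq : (al * q < a * q)%N.
  have pq : (p * a < q * a)%N by rewrite ltn_mul2r a0; lia.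
  by rewrite (mulnC a q); lia.
have beq : (be * q < (b + 1) * q)%N.
  have pq : (p * b <= q * b)%N by rewrite leq_mul2r; lia.
  by rewrite mulnDl (mulnC b q); lia.
have ala : (al < a)%N by move: alq; rewrite ltn_mul2r => /andP[].
have beb : (be <= b)%N by move: beq; rewrite ltn_mul2r addn1 => /andP[].
have posQ n : (0 < n)%N -> 0 < n%:Q by move=> n0; rewrite (ltr_int _ 0).
have aQ := posQ _ a0; have bQ := posQ _ b0; have qQ := posQ _ q0.
exists (al%:Q / a%:Q), (be%:Q / b%:Q); split=> //.
rewrite /admissible /farey_neighbors /reduced_frac nA dA nB dB nQ dQ.
split; first by rewrite divr_ge0 ?ler_pdivrMr ?mul1r ?(ler_int _ 0) ?ler_int //; lia.
split; first by rewrite divr_ge0 ?ler_pdivrMr ?mul1r ?(ler_int _ 0) ?ler_int //; lia.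
split; first lia.
split.
  left; rewrite !ltr_pdivrMr // -!mulrA ![_^-1 * _]mulrC !mulrA !ltr_pdivlMr //.
  by rewrite -!intrM !ltr_int; apply/andP; split; lia.
by split; lia.
Qed.

(** * The facets of the convex hull *)

Lemma xpt_vertex (R : realType) (q p : nat) (n : int) (a b : nat) (j : 'I_4) :
  xpt R q p (vertex n a b j)
  = [:: xpt R q p n; xpt R q p (n + a%:Z); xpt R q p (n + b%:Z);
        xpt R q p (n + a%:Z + b%:Z)]`_j.
Proof.
by case: j => -[|[|[|[|//]]]] ? /=; rewrite /vertex /= ?addr0 ?addrA.
Qed.

Lemma xpt_in_orbit (R : realType) (q p : nat) (k : int) : (0 < q)%N ->
  [set xpt R q p (Posz m) | m in [set m | (m < q)%N]] (xpt R q p k).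
Proof.
move=> q0; have qn : q%:Z != 0 by lia.
have m0 := modz_ge0 k qn; have mq : (k %% q%:Z)%Z < q%:Z by apply: ltz_pmod; lia.
exists `|(k %% q%:Z)%Z|%N; first by rewrite /=; lia.
by rewrite gez0_abs // [in RHS](divz_eq k q%:Z) addrC xpt_periodic.
Qed.

(** Only n modulo q matters, so the family is indexed by a finite type. *)
Lemma tet_pivot_family (R : realType) (q p : nat) :
  (5 <= q)%N -> (2 <= p <= q - 2)%N -> coprime p q ->
  pivot_family [set xpt R q p (Posz m) | m in [set m | (m < q)%N]]
    (fun i : 'I_q * 'I_q * 'I_q => `[< tet_pair q p i.1.2 i.2 >])
    (fun i j => xpt R q p (vertex (Posz i.1.1) i.1.2 i.2 j))
    (fun i => support_functional R q p i.1.2 i.2 (Posz i.1.1)).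
Proof.
move=> q5 hp cop [[n a] b] /= /asboolP tp; have q0 : (0 < q)%N by lia.
have vin j : in_tet q n a b (vertex n a b j) by exists j, 0; rewrite mul0r addr0.
split=> [j|_ [k _ <-]|j|j].
- exact: xpt_in_orbit.
- have [eq1 lt1] := @support_functional_le1 R q p a b n k hp tp.
  by have [/eq1->//|/lt1/ltW] := pselect (in_tet q n a b k).
- exact: (@support_functional_le1 R q p a b n _ hp tp).1 (vin j).
- have pq : (p <= q)%N by lia.
  have [n' [a' [b' [tp' inT notin]]]] := @tet_pivot q p a b n j q5 pq cop tp.
  have /andP[aq bq] := tet_pair_lt tp'.
  have qn : q%:Z != 0 by lia.
  have m0 := modz_ge0 n' qn.
  have mq : (n' %% q%:Z)%Z < q%:Z by apply: ltz_pmod; lia.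
  have mq' : (`|(n' %% q%:Z)%Z| < q)%N by lia.
  have mE : Posz `|(n' %% q%:Z)%Z| = (n' %% q%:Z)%Z by rewrite gez0_abs.
  exists (Ordinal mq', Ordinal aq, Ordinal bq); rewrite /= mE.
  have inE k : in_tet q n' a' b' k <-> in_tet q (n' %% q%:Z)%Z a' b' k.
    by rewrite {1}(divz_eq n' q%:Z) addrC; exact: in_tet_mod.
  split; first exact/asboolP.
  + by move=> k /inT/inE; exact: (@support_functional_le1 R q p a' b' _ _ hp tp').1.
  + by apply: (@support_functional_le1 R q p a' b' _ _ hp tp').2 => /inE.
Qed.

Theorem theorem3 (R : realType) (q p : nat)
    (hq : (5 <= q)%N) (hp : (2 <= p <= q - 2)%N) (hpq : coprime p q)
    (F : set 'rV[R]_4)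
    (hface : is_face (@Pi_hull R q p) F) (hdim : has_affine_dim F 3) :
  exists (n : int) (A B : rat),
    admissible (p%:Q / q%:Q) A B /\
    is_tetrahedron_on F
      (@xpt R q p n)
      (@xpt R q p (n + denq A))
      (@xpt R q p (n + denq B))
      (@xpt R q p (n + denq A + denq B)).
Proof.
have q0 : (0 < q)%N by lia.
have [a0 [b0 tp0]] := tet_pair_exists hq hp hpq.
have /andP[a0q b0q] := tet_pair_lt tp0.
have P0 : `[< tet_pair q p (Ordinal a0q) (Ordinal b0q) >] by apply/asboolP.
have [[[n a] b] [/asboolP/= tp indep FE]] :=
  @pivot_family_facet R 3 _ _ _ _ _ (@tet_pivot_family R q p hq hp hpq)
    (Ordinal q0, Ordinal a0q, Ordinal b0q) F P0 hface hdim.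
have [A [B [adm dA dB]]] : exists A B : rat,
    [/\ admissible (p%:Q / q%:Q) A B, denq A = a & denq B = b].
  case: tp => y [z [al [be [H|H]]]].
  - exact: oriented_pair_admissible hp hpq H.
  - have [A [B [adm dA dB]]] := oriented_pair_admissible hp hpq H.
    by exists B, A; split=> //; exact: admissible_sym.
exists n, A, B; split=> //; rewrite dA dB; split.
- move: indep; rewrite /affinely_independent.
  by under eq_mx do rewrite !xpt_vertex.
- rewrite FE; congr conv_hull; apply/seteqP; split=> x /=.
  + by case=> j _ <-; rewrite xpt_vertex mem_nth.
  + move=> /(nthP 0)[j j4 <-]; exists (Ordinal (j4 : (j < 4)%N)) => //.
    by rewrite xpt_vertex.
Qed.
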